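(* Let $G$ be a finite group. (1) If $G$ is abelian, then $G$ is a K$2$PCI-group if and only if every Sylow $3$-subgroup of $G$ is isomorphic to $\mathbb{Z}_3$, $\mathbb{Z}_3\times\mathbb{Z}_3$ or $\mathbb{Z}_9$, every Sylow $p$-subgroup of $G$ with $p\neq 3$ is either elementary abelian or isomorphic to $\mathbb{Z}_4$, and for every subset $S\subseteq G$ the $2$-PCayley graph $\mathrm{BCay}(\langle S\rangle,S)$ of the group $\langle S\rangle$ is K$2$PCI. (2) If $G$ is non-abelian, then $G$ is a K$2$PCI-group if and only if $G$ is isomorphic to one of $D_6$, $Q_8$, $D_{10}$.
   Context: $D_{2n}$ denotes the dihedral group of order $2n$, $Q_8$ the quaternion group. For a finite group $H$ and $S\subseteq H$, $\mathrm{BCay}(H,S)$ is the bipartite graph with vertex set $H_1\cup H_2$, $H_i=\{x_i:x\in H\}$ two disjoint copies of $H$, and edges $\{x_1,(sx)_2\}$ for $s\in S$, $x\in H$ (a $2$-PCayley graph of $H$). Let $R(g):x_i\mapsto (xg)_i$, $R(H)=\{R(g):g\in H\}$, let $N$ be the normalizer of $R(H)$ in the symmetric group on $H_1\cup H_2$, and $K$ the kernel of the action of $N$ on $\{H_1,H_2\}$. A $2$-PCayley graph $\Gamma$ of $H$ is K$2$PCI if for every $2$-PCayley graph $\Sigma$ of $H$ such that some isomorphism $\Gamma\to\Sigma$ maps $\{H_1,H_2\}$ to itself, there is $k\in K$ with $\Gamma^k=\Sigma$. $H$ is a K$2$PCI-group if every $2$-PCayley graph of $H$ is K$2$PCI.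
   Formalization: The condition that every Sylow 3-subgroup is isomorphic to Z_3, Z_3×Z_3 or Z_9 is imposed only when 3 divides |G|; read literally, with the trivial group as a Sylow 3-subgroup, the claim fails for G = Z_2. *)

(* Defs.v *)
From HB Require Import structures.
From mathcomp Require Import all_boot all_fingroup all_algebra all_solvable.

Set Implicit Arguments.
Unset Strict Implicit.
Unset Printing Implicit Defensive.

Local Open Scope group_scope.

(* A simple graph on a fixed vertex set is represented by its set of edges,   *)
(* each edge being a two-element set of vertices.                             *)

(* gimage f E is the graph E^f; hence a permutation f of the vertices is an   *)
(* isomorphism from the graph E to the graph E' iff gimage f E = E'.          *)
Definition gimage (V : finType) (f : {perm V}) (E : {set {set V}}) :
  {set {set V}} := [set f @: e | e : {set V} in E].

Section TwoPCayley.

Variable H : finGroupType.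

(* The disjoint union of two copies of H: inl x is x_1 and inr x is x_2. *)
Definition vert : finType := (H + H)%type.

Definition part1 : {set vert} := [set inl x | x : H].
Definition part2 : {set vert} := [set inr x | x : H].
Definition parts : {set {set vert}} := [set part1; part2].

Definition BCay (S : {set H}) : {set {set vert}} :=
  [set [set (inl x : vert); (inr (s * x) : vert)] | s in S, x in [set: H]].

Definition is_2PCayley (E : {set {set vert}}) : Prop :=
  exists S : {set H}, E = BCay S.

Definition rtrans_fun (g : H) (v : vert) : vert :=
  match v with inl x => inl (x * g) | inr x => inr (x * g) end.

Lemma rtrans_fun_inj (g : H) : injective (rtrans_fun g).
Proof. by move=> [x|x] [y|y] //= [] /mulIg ->. Qed.

Definition rtrans (g : H) : {perm vert} := perm (@rtrans_fun_inj g).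

Definition rtransH : {set {perm vert}} := [set rtrans g | g : H].

Definition rnorm : {set {perm vert}} := 'N(rtransH).

(* The action on parts is the one induced on sets of vertices by the natural  *)
(* action of permutations; its kernel is the pointwise stabiliser of parts.   *)
Definition rker : {set {perm vert}} := 'C_rnorm(parts | 'P^*).

(* The isomorphism f may fix or swap the two parts. *)
Definition K2PCI (E : {set {set vert}}) : Prop :=
  forall E' : {set {set vert}}, is_2PCayley E' ->
    (exists f : {perm vert},
        gimage f E = E' /\ [set f @: A | A : {set vert} in parts] = parts) ->
    exists2 k : {perm vert}, k \in rker & gimage k E = E'.

Definition K2PCI_group : Prop :=
  forall E : {set {set vert}}, is_2PCayley E -> K2PCI E.

End TwoPCayley.

(* Main.v *)
Require Import Defs.
From mathcomp Require Import all_boot all_fingroup all_algebra all_solvable.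
From mathcomp Require Import zify.

Set Implicit Arguments.
Unset Strict Implicit.
Unset Printing Implicit Defensive.

(** The kernel K maps BCay(H,S) to the graphs BCay(H, g S^a) with g in H and a
    in Aut(H), and swapping the parts of BCay(H,S) gives BCay(H, S^-1).  So
    BCay(H,S) is K2PCI iff every T with BCay(H,T) isomorphic to BCay(H,S) by a
    map fixing the parts is of the form g S^a, and so is S^-1.

    For subgroups L, M of the same order BCay(H,L) and BCay(H,M) are disjoint
    unions of equally many complete bipartite graphs, so in a K2PCI-group
    subgroups of equal order are conjugate under Aut(H); Sylow subgroups are
    then elementary abelian or cyclic in the abelian case.  Large cyclic and
    elementary abelian Sylow subgroups are excluded by explicit pairs S, T.
    Conversely, if all Sylow subgroups are homogeneous, isomorphisms between
    subgroups extend to automorphisms, and everything reduces to <S>.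

    In the non-abelian case S^-1 = g S^a for S = U u bU makes every subgroup U
    of odd order normal, so the elements of odd order form an abelian group A.
    If A is not central, b inverts A and the sets X u bX force |A| = 3 or 5 and
    G = A<b>; if A is central, a Sylow 2-subgroup is Q_8, and a set meeting the
    four cosets of Z(G) in subsets of different sizes forces A = 1.  For the
    three groups left, the number of closed walks of length 6 in BCay(H,S)
    determines S up to affine equivalence, by enumeration. *)

Local Open Scope group_scope.

(** * Affine equivalence and isomorphism *)

(** The two conditions on S play opposite roles. In an abelian group inversion is an automorphism,
    so S^-1 = g S^a always holds and only part-preserving isomorphisms matter. In a non-abelian
    K2PCI-group the condition on S^-1 supplies most of the structure, and isomorphisms enter only
    through subgroups of equal order. The obstacle in the abelian case is that K2PCI over <S> yields
    automorphisms of <S>, not of G, and that <S> changes when S is translated. Homogeneity of the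
    Sylow subgroups settles the former; translating S so that it contains 1 settles the latter. The
    excluding pairs S, T exploit that a graph isomorphism may transform one coset of a subgroup and
    leave another alone, or negate a value such as s - t^2 on F_3^3, whereas an automorphism is
    determined by its values on generators. *)

Section Reduction.

Variable H : finGroupType.
Implicit Types (S T : {set H}) (f : {perm vert H}).

(* BCay T is the image of BCay S under an element of the kernel K. *)
Definition affine_equiv S T : Prop :=
  exists (g : H) (a : {perm H}),
    {morph a : x y / x * y} /\ T = [set g * a x | x in S].

(* (f1, f2) is an isomorphism from BCay S to BCay T fixing both parts. *)
Definition haar_iso S T : Prop :=
  exists f1 f2 : {perm H},
    forall x y, (y * x^-1 \in S) = (f2 y * (f1 x)^-1 \in T).

Lemma morph_perm1 (a : {perm H}) : {morph a : x y / x * y} -> a 1 = 1.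
Proof. by move=> aM; apply: (mulgI (a 1)); rewrite -aM !mulg1. Qed.

Lemma morph_permV (a : {perm H}) : {morph a : x y / x * y} -> {morph a : x / x^-1}.
Proof.
by move=> aM x; apply: (mulgI (a x)); rewrite -aM !mulgV morph_perm1.
Qed.

Lemma affine_equiv_trans S T U :
  affine_equiv S T -> affine_equiv T U -> affine_equiv S U.
Proof.
move=> [g [a [aM ->]]] [h [b [bM ->]]]; exists (h * b g), (a * b); split.
  by move=> x y; rewrite !permM aM bM.
rewrite -imset_comp; apply: eq_imset => x /=.
by rewrite permM bM mulgA.
Qed.

Lemma affine_equiv_sym S T : affine_equiv S T -> affine_equiv T S.
Proof.
move=> [g [a [aM ->]]].
have aVM : {morph a^-1 : x y / x * y}.
  by move=> x y; apply: (@perm_inj _ a); rewrite aM !permKV.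
exists (a^-1 g)^-1, a^-1; split=> //.
rewrite -imset_comp -[LHS]imset_id; apply: eq_imset => x /=.
by rewrite aVM permK mulKg.
Qed.

(** Since (g a(s))^-1 = g^-1 (g a(s^-1) g^-1), the translation returns to the left at the price of
    an inner automorphism. *)
Lemma affine_equivV S T : affine_equiv S T -> affine_equiv S^-1 T^-1.
Proof.
move=> [g [a [aM ->]]].
have i : injective (fun x => g * a x * g^-1).
  by move=> x y /mulIg/mulgI/perm_inj.
exists g^-1, (perm i); split=> [x y|].
  by rewrite !permE aM !mulgA mulgKV.
apply/setP=> x; rewrite inE.
apply/imsetP/imsetP=> -[s sS e].
  exists s^-1; first by rewrite inE invgK.
  by rewrite permE (morph_permV aM) -[LHS]invgK e invMg !mulgA mulVg mul1g.
exists s^-1; first by rewrite inE in sS.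
by rewrite e permE -mulgA mulKg invMg invgK (morph_permV aM).
Qed.

Lemma edge_inj (x x' y y' : H) :
  [set (inl x : vert H); (inr y : vert H)] = [set inl x'; inr y'] ->
  x = x' /\ y = y'.
Proof.
move=> /setP E; split.
  by have:= E (inl x); rewrite !inE eqxx /= orbF => /esym/eqP[].
by have:= E (inr y); rewrite !inE eqxx /= => /esym/eqP[].
Qed.

Lemma edge_BCay S (x y : H) :
  ([set (inl x : vert H); (inr y : vert H)] \in BCay S) = (y * x^-1 \in S).
Proof.
apply/imset2P/idP => [[s x' sS _ /edge_inj[-> ->]]|yx].
  by rewrite mulgK.
by exists (y * x^-1) x; rewrite ?inE ?mulgKV.
Qed.

Lemma BCayP S (e : {set vert H}) :
  reflect (exists x y, y * x^-1 \in S /\ e = [set inl x; inr y]) (e \in BCay S).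
Proof.
apply: (iffP imset2P) => [[s x sS _ ->]|[x [y [yx ->]]]].
  by exists x, (s * x); rewrite mulgK.
by exists (y * x^-1) x; rewrite ?inE ?mulgKV.
Qed.

Lemma imset_pair (aT rT : finType) (h : aT -> rT) (u v : aT) :
  h @: [set u; v] = [set h u; h v].
Proof. by rewrite imsetU !imset_set1. Qed.

Lemma mem_gimage (V : finType) (f : {perm V}) (E : {set {set V}}) (e : {set V}) :
  (f @: e \in gimage f E) = (e \in E).
Proof. exact: (mem_imset _ _ (imset_inj (@perm_inj _ f))). Qed.

Lemma gimage_BCay S T f (f1 f2 : {perm H}) :
    (forall x, f (inl x) = inl (f1 x)) -> (forall y, f (inr y) = inr (f2 y)) ->
  (gimage f (BCay S) = BCay T) <->
  (forall x y, (y * x^-1 \in S) = (f2 y * (f1 x)^-1 \in T)).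
Proof.
move=> fl fr.
have fe x y : f @: [set (inl x : vert H); (inr y : vert H)]
               = [set inl (f1 x); inr (f2 y)] by rewrite imset_pair fl fr.
split=> [E x y|E].
  by rewrite -edge_BCay -(mem_gimage f) fe E edge_BCay.
apply/setP=> e; apply/imsetP/BCayP => [[_ /BCayP[x [y [yx ->]]] ->]|].
  by exists (f1 x), (f2 y); rewrite -E.
move=> [x [y [yx ->]]]; exists [set inl (f1^-1 x); inr (f2^-1 y)].
  by rewrite edge_BCay E !permKV.
by rewrite fe !permKV.
Qed.

(** A swap carries the edge {x_1, y_2} to {(f2 y)_1, (f1 x)_2}, so the quotient of the images is
    read backwards and T^-1 takes the place of T. *)
Lemma gimage_swap_BCay S T f (f1 f2 : {perm H}) :
    (forall x, f (inl x) = inr (f1 x)) -> (forall y, f (inr y) = inl (f2 y)) ->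
  gimage f (BCay S) = BCay T -> haar_iso S T^-1.
Proof.
move=> fl fr E; exists f1, f2 => x y.
rewrite -edge_BCay -(mem_gimage f) imset_pair fl fr E setUC edge_BCay.
by rewrite inE invMg invgK.
Qed.

Lemma vert_perm (h1 h2 : {perm H}) : exists f : {perm vert H},
  (forall x, f (inl x) = inl (h1 x)) /\ (forall y, f (inr y) = inr (h2 y)).
Proof.
pose h (v : vert H) : vert H :=
  match v with inl x => inl (h1 x) | inr y => inr (h2 y) end.
have h_inj : injective h by move=> [x|x] [y|y] //= [] /perm_inj->.
by exists (perm h_inj); split=> x; rewrite permE.
Qed.

Lemma inlr_part : part1 H != part2 H.
Proof.
apply/negP=> /eqP/setP/(_ (inl 1)).
by rewrite imset_f //; case/esym/imsetP.
Qed.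

Lemma in_part1 (v : vert H) : (v \in part1 H) = (if v is inl _ then true else false).
Proof.
by case: v => x; [rewrite imset_f | apply/imsetP => -[]].
Qed.

Lemma in_part2 (v : vert H) : (v \in part2 H) = (if v is inr _ then true else false).
Proof.
by case: v => x; [apply/imsetP => -[] | rewrite imset_f].
Qed.

(** [P] is true when f fixes the two parts and false when it swaps them. *)
Lemma part_perm f (P : bool) :
    f @: part1 H = (if P then part1 H else part2 H) ->
    f @: part2 H = (if P then part2 H else part1 H) ->
  exists h1 h2 : {perm H},
    (forall x, f (inl x) = if P then inl (h1 x) else inr (h1 x)) /\
    (forall x, f (inr x) = if P then inr (h2 x) else inl (h2 x)).
Proof.
move=> f1E f2E.
pose pr (v : vert H) : H := match v with inl x => x | inr x => x end.
have E1 x : f (inl x) = if P then inl (pr (f (inl x))) else inr (pr (f (inl x))).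
  have: f (inl x) \in f @: part1 H by rewrite !imset_f.
  by rewrite f1E; case: (P); rewrite ?in_part1 ?in_part2; case: (f _).
have E2 x : f (inr x) = if P then inr (pr (f (inr x))) else inl (pr (f (inr x))).
  have: f (inr x) \in f @: part2 H by rewrite !imset_f.
  by rewrite f2E; case: (P); rewrite ?in_part1 ?in_part2; case: (f _).
have i1 : injective (fun x => pr (f (inl x))).
  move=> x y e; suff /perm_inj[]: f (inl x) = f (inl y) by [].
  by rewrite E1 e -E1.
have i2 : injective (fun x => pr (f (inr x))).
  move=> x y e; suff /perm_inj[]: f (inr x) = f (inr y) by [].
  by rewrite E2 e -E2.
by exists (perm i1), (perm i2); split=> x; rewrite permE.
Qed.

Lemma parts_iso f : [set f @: A | A : {set vert H} in parts H] = parts H ->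
  exists P : bool, f @: part1 H = (if P then part1 H else part2 H) /\
                   f @: part2 H = (if P then part2 H else part1 H).
Proof.
have n12 := inlr_part.
rewrite imset_pair => /setP E.
have := E (f @: part1 H); have := E (f @: part2 H); rewrite !inE !eqxx orbT /=.
have ne: f @: part1 H != f @: part2 H.
  by apply: contraNneq n12 => /(imset_inj (@perm_inj _ f)) ->.
move=> /esym/orP[]/eqP e2 /esym/orP[]/eqP e1; move: ne; rewrite e1 e2 ?eqxx //.
  by exists false.
by exists true.
Qed.

(** Conjugation by k sends R(g) to some R(g') with the same g' on both copies of H. Evaluating at
    the identity gives g' = h1(1)^-1 h1(g), the common automorphism; the images u and v of the two
    identities remain independent. *)
Lemma rker_morph k : k \in rker H ->
  exists (a : {perm H}) (u v : H), {morph a : x y / x * y} /\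
    forall x, k (inl x) = inl (u * a x) /\ k (inr x) = inr (v * a x).
Proof.
case/setIP=> /normP nk fix_k.
have p1 : k @: part1 H = part1 H.
  by move/astabP: (fix_k) => /(_ (part1 H)); apply; rewrite !inE eqxx.
have p2 : k @: part2 H = part2 H.
  by move/astabP: (fix_k) => /(_ (part2 H)); apply; rewrite !inE eqxx orbT.
have [h1 [h2 [k1 k2]]] := @part_perm k true p1 p2; rewrite /= in k1 k2.
have kR g : exists g', forall x, h1 (x * g) = h1 x * g' /\ h2 (x * g) = h2 x * g'.
  have: rtrans g ^ k \in rtransH H.
    by rewrite -nk memJ_conjg; apply: imset_f.
  case/imsetP=> g' _ /permP E; exists g' => x.
  have := E (k (inl x)); have := E (k (inr x)).
  by rewrite !permJ k1 k2 !permE /= k1 k2 => -[->] [->].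
have aE g x : h1 (x * g) = h1 x * ((h1 1)^-1 * h1 g)
           /\ h2 (x * g) = h2 x * ((h1 1)^-1 * h1 g).
  have [g' E] := kR g; have [-> ->] := E x.
  by have := E 1; rewrite mul1g => -[-> _]; rewrite mulKg.
have a_inj : injective (fun g => (h1 1)^-1 * h1 g) by move=> x y /mulgI/perm_inj.
exists (perm a_inj), (h1 1), (h2 1); split=> [x y|x]; rewrite !permE.
  by have [-> _] := aE y x; rewrite !mulgA.
by rewrite k1 k2 mulKVg; have [_ <-] := aE x 1; rewrite mul1g.
Qed.

Lemma rker_affine k S T :
  k \in rker H -> gimage k (BCay S) = BCay T -> affine_equiv S T.
Proof.
move=> /rker_morph[a [u [v [aM kE]]]].
have i w : injective (fun x => w * a x) by move=> x y /mulgI/perm_inj.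
move=> /(@gimage_BCay S T k (perm (i u)) (perm (i v))) E.
(* The image of S is v a(S) u^-1 = (v u^-1)(u a(S) u^-1). *)
have b_inj : injective (fun x => u * a x * u^-1).
  by move=> x y /mulIg/mulgI/perm_inj.
exists (v * u^-1), (perm b_inj); split=> [x y|].
  by rewrite !permE aM !mulgA mulgKV.
have {}E x y : (y * x^-1 \in S) = (v * a y * (u * a x)^-1 \in T).
  by rewrite E ?permE // => z; rewrite permE; have [] := kE z.
have {}E x : (x \in S) = (v * a x * u^-1 \in T).
  by rewrite -[x]mulg1 -{1}invg1 E morph_perm1 // !mulg1.
apply/setP=> x; apply/idP/imsetP => [xT|[y yS ->]].
  exists (a^-1 (v^-1 * x * u)); first by rewrite E permKV !mulgA mulgV mul1g mulgK.
  by rewrite [perm b_inj _]permE permKV !mulgA !mulgKV ?mulgV ?mul1g ?mulgK.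
by rewrite permE !mulgA mulgKV -E.
Qed.

Lemma affine_rker S T : affine_equiv S T ->
  exists2 k : {perm vert H}, k \in rker H & gimage k (BCay S) = BCay T.
Proof.
move=> [g [a [aM ->]]].
have i : injective (fun x => g * a x) by move=> x y /mulgI/perm_inj.
have [k [kl kr]] := vert_perm a (perm i).
have kr' y : k (inr y) = inr (g * a y) by rewrite kr permE.
exists k; last first.
  apply/(gimage_BCay _ _ kl kr) => x y; rewrite permE -mulgA -morph_permV // -aM.
  by rewrite (mem_imset _ _ i).
have kp1: k @: part1 H = part1 H.
  apply/setP=> -[] x; rewrite in_part1.
    apply/imsetP; exists (inl (a^-1 x)); rewrite ?in_part1 //.
    by rewrite kl permKV.
  by apply/imsetP=> -[[] y]; rewrite in_part1 ?kl.
have kp2: k @: part2 H = part2 H.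
  apply/setP=> -[] x; rewrite in_part2.
    by apply/imsetP=> -[[] y]; rewrite in_part2 ?kr.
  apply/imsetP; exists (inr (a^-1 (g^-1 * x))); rewrite ?in_part2 //.
  by rewrite kr' permKV mulKVg.
apply/setIP; split.
  rewrite inE; apply/subsetP=> _ /imsetP[_ /imsetP[h _ ->] ->].
  apply/imsetP; exists (a h) => //; apply/permP=> v.
  rewrite -(permKV k v) permJ permE.
  case: (k^-1 v) => x; rewrite ?kl ?kr' permE /= ?kl ?kr' ?aM ?mulgA //.
apply/astabP=> A; rewrite !inE => /orP[]/eqP->.
  exact: kp1.
exact: kp2.
Qed.

Lemma K2PCI_BCayP S :
  K2PCI (BCay S) <->
  (forall T, haar_iso S T -> affine_equiv S T) /\ affine_equiv S S^-1.
Proof.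
split=> [Si|[SiT SiV] E' [T ->{E'}] [f [fE /parts_iso[P [fp1 fp2]]]]].
  split=> [T [f1 [f2 E]]|].
    have [f [fl fr]] := vert_perm f1 f2.
    have [||k kK kE] := Si (BCay T); first by exists T.
      exists f; split; first exact/(gimage_BCay _ _ fl fr).
      have fp1: f @: part1 H = part1 H.
        apply/setP=> -[] x; rewrite in_part1.
          by apply/imsetP; exists (inl (f1^-1 x)); rewrite ?in_part1 // fl permKV.
        by apply/imsetP=> -[[] y]; rewrite in_part1 ?fl.
      have fp2: f @: part2 H = part2 H.
        apply/setP=> -[] x; rewrite in_part2.
          by apply/imsetP=> -[[] y]; rewrite in_part2 ?fr.
        by apply/imsetP; exists (inr (f2^-1 x)); rewrite ?in_part2 // fr permKV.
      by rewrite imset_pair fp1 fp2.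
    exact: (rker_affine kK).
  have sw_inj : injective (fun v : vert H => match v with inl x => inr x | inr x => inl x end : vert H).
    by move=> [x|x] [y|y] //= [] ->.
  pose f := perm sw_inj.
  have fl x : f (inl x) = inr x by rewrite permE.
  have fr x : f (inr x) = inl x by rewrite permE.
  have [||k kK kE] := Si (BCay S^-1); first by exists S^-1.
    exists f; split.
      apply/setP=> e; apply/imsetP/BCayP=> [[_ /BCayP[x [y [yx ->]]] ->]|[x [y [yx ->]]]].
        by exists y, x; rewrite imset_pair fl fr setUC inE invMg invgK.
      exists [set inl y; inr x]; last by rewrite imset_pair fl fr setUC.
      by rewrite edge_BCay; move: yx; rewrite inE invMg invgK.
    have fp1: f @: part1 H = part2 H.
      apply/setP=> -[] x; rewrite in_part2; last first.
        by apply/imsetP; exists (inl x); rewrite ?in_part1 ?fl.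
      by apply/imsetP=> -[[] y]; rewrite in_part1 ?fl.
    have fp2: f @: part2 H = part1 H.
      apply/setP=> -[] x; rewrite in_part1; last first.
        by apply/imsetP=> -[[] y]; rewrite in_part2 ?fr.
      by apply/imsetP; exists (inr x); rewrite ?in_part2 ?fr.
    by rewrite imset_pair fp1 fp2 setUC.
  exact: (rker_affine kK).
apply: affine_rker.
have [h1 [h2 []]] := @part_perm f P fp1 fp2; case: P {fp1 fp2} => fl fr.
  by apply: SiT; exists h1, h2; apply/(gimage_BCay _ _ fl fr).
have [g [a [aM TE]]] : affine_equiv S T^-1.
  by apply: SiT; apply: (gimage_swap_BCay fl fr).
(* A swap makes S equivalent to T^-1, hence S^-1 to T; the equivalence of S and S^-1 closes the
   chain. *)
have := gimage_swap_BCay fl fr fE.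
move=> /SiT/affine_equivV; rewrite invgK => E; exact: affine_equiv_trans E.
Qed.

End Reduction.

(** * Part-preserving isomorphisms: construction, lifting and restriction *)

Section HaarIso.

Variable H : finGroupType.
Implicit Types (S T : {set H}) (L M : {group H}).

Lemma affine_equiv_haar S T : affine_equiv S T -> haar_iso S T.
Proof.
move=> [g [a [aM ->]]].
have i : injective (fun x => g * a x) by move=> x y /mulgI/perm_inj.
exists a, (perm i) => x y.
by rewrite permE -mulgA -morph_permV // -aM (mem_imset _ _ i).
Qed.

Lemma haar_iso_sym S T : haar_iso S T -> haar_iso T S.
Proof.
by move=> [f1 [f2 E]]; exists f1^-1, f2^-1 => x y; rewrite E !permKV.
Qed.

Lemma haar_iso_trans S T U : haar_iso S T -> haar_iso T U -> haar_iso S U.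
Proof.
move=> [f1 [f2 E]] [h1 [h2 F]]; exists (f1 * h1), (f2 * h2) => x y.
by rewrite E F !permM.
Qed.

Lemma affine_equiv_mull g S : affine_equiv S (g *: S).
Proof.
exists g, 1; split=> [x y|]; first by rewrite !perm1.
by rewrite -lcosetE; apply: eq_imset => x; rewrite perm1.
Qed.

Section CosetMap.

Variable L : {group H}.
Implicit Type f : H -> H.

Let r x := repr (L :* x).

Lemma mem_coset_repr x : x * (r x)^-1 \in L.
Proof.
by rewrite -mem_rcoset (rcoset_eqP (mem_repr_rcoset L x)) rcoset_refl.
Qed.

Lemma coset_repr_mul u x : u \in L -> r (u * r x) = r x.
Proof.
move=> Lu; congr repr; apply: rcoset_eqP.
by rewrite mem_rcoset -mulgA -[r x * _]invgK invMg invgK groupM // groupV mem_coset_repr.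
Qed.

Lemma eq_coset_repr x y : (y * x^-1 \in L) = (r x == r y).
Proof.
apply/idP/eqP => [|e].
  by rewrite -mem_rcoset => /rcoset_eqP; rewrite /r => ->.
rewrite -[y](mulgKV (r y)) -e -mulgA groupM ?mem_coset_repr //; first by rewrite e mem_coset_repr.
by rewrite -groupV invMg invgK mem_coset_repr.
Qed.

(** Repeats f on every right coset of L, each identified with L through its representative. *)
Definition coset_map f y := f (y * (r y)^-1) * r y.

Lemma coset_map_repr f x : {in L, forall z, f z \in L} -> r (coset_map f x) = r x.
Proof. by move=> fL; rewrite coset_repr_mul // fL ?mem_coset_repr. Qed.

Lemma coset_map_inj f :
  {in L, forall z, f z \in L} -> {in L &, injective f} ->
  injective (coset_map f).
Proof.
move=> fL fI x y e.
have er : r x = r y by rewrite -(coset_map_repr x fL) e coset_map_repr.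
apply: (mulIg (r x)^-1); rewrite {2}er; apply: fI; rewrite ?mem_coset_repr //.
by move: e; rewrite /coset_map er => /mulIg.
Qed.

Lemma coset_map_div f h x y : r x = r y ->
  coset_map h y * (coset_map f x)^-1 = h (y * (r y)^-1) * (f (x * (r y)^-1))^-1.
Proof. by move=> er; rewrite /coset_map er invMg mulgA mulgK. Qed.

(** With S and T inside L, edges stay within right cosets of L. Both graphs are disjoint unions of
    copies of graphs over L, and f1, f2 act in each copy. *)
Lemma haar_iso_lift S T (f1 f2 : H -> H) :
    S \subset L -> T \subset L ->
    {in L, forall z, f1 z \in L} -> {in L, forall z, f2 z \in L} ->
    {in L &, injective f1} -> {in L &, injective f2} ->
    {in L &, forall x y, (y * x^-1 \in S) = (f2 y * (f1 x)^-1 \in T)} ->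
  haar_iso S T.
Proof.
move=> SL TL f1L f2L f1I f2I E.
exists (perm (coset_map_inj f1L f1I)), (perm (coset_map_inj f2L f2I)) => x y.
rewrite !permE.
have [er|ner] := eqVneq (r x) (r y).
  rewrite coset_map_div // -E ?mem_coset_repr -?er ?mem_coset_repr // er.
  by rewrite invMg invgK mulgA mulgKV.
have nL : y * x^-1 \notin L by rewrite eq_coset_repr.
rewrite (contraNF (subsetP SL _) nL) (contraNF (subsetP TL _)) //.
by rewrite eq_coset_repr !coset_map_repr.
Qed.

End CosetMap.

(** Each fibre of p is listed next to the fibre of q over the same value, and equal positions are
    matched; the hypothesis makes the lists equally long. *)
Lemma fiber_perm (p q : H -> nat) :
  (forall x, #|[set y | q y == p x]| = #|[set y | p y == p x]|) ->
  exists f : {perm H}, forall x, q (f x) = p x.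
Proof.
move=> card_pq.
pose P x := enum [set y | p y == p x]; pose Q x := enum [set y | q y == p x].
pose f x := nth x (Q x) (index x (P x)).
have lt_ix x : index x (P x) < size (Q x).
  by rewrite -cardE card_pq cardE index_mem mem_enum inE.
have qf x : q (f x) = p x.
  by have := mem_nth x (lt_ix x); rewrite -/(f x) mem_enum inE => /eqP.
have f_inj : injective f.
  move=> x y e; have pxy : p x = p y by rewrite -!qf e.
  have [eP eQ] : P x = P y /\ Q x = Q y by rewrite /P /Q pxy.
  move: e (lt_ix x) (lt_ix y); rewrite /f eQ eP => e ltx lty.
  have xP : x \in P y by rewrite -eP mem_enum inE.
  have yP : y \in P y by rewrite mem_enum inE.
  apply: (index_inj x xP yP); apply/eqP.
  rewrite -(nth_uniq x ltx lty) ?enum_uniq // e.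
  exact/eqP/set_nth_default.
by exists (perm f_inj) => x; rewrite permE.
Qed.

(** With right cosets numbered, y x^-1 lies in K iff x and y carry the same number. L and M have
    equally many cosets of the same size, so one permutation turns the numbering for L into that for
    M, and it serves on both parts. *)
Lemma haar_iso_subgroup L M : #|L| = #|M| -> haar_iso L M.
Proof.
move=> eLM.
pose rk (K : {group H}) x := index (K :* x) (enum (rcosets K [set: H])).
have rk_in (K : {group H}) x : K :* x \in enum (rcosets K [set: H]).
  by rewrite mem_enum; apply/rcosetsP; exists x.
have rk_eq K x y : (rk K x == rk K y) = (y * x^-1 \in K).
  rewrite -mem_rcoset; apply/eqP/idP => [e|/rcoset_eqP e].
    by rewrite (index_inj set0 (rk_in K x) (rk_in K y) e) rcoset_refl.
  by rewrite /rk e.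
have card_rk (K : {group H}) x : #|[set y | rk K y == rk K x]| = #|K|.
  rewrite -(card_rcoset K x); apply: eq_card => y.
  by rewrite inE eq_sym rk_eq mem_rcoset.
have [|f fE] := @fiber_perm (rk L) (rk M).
  move=> x; rewrite card_rk eLM.
  have lt_i : rk L x < size (enum (rcosets M [set: H])).
    have eI : #|rcosets M [set: H]| = #|rcosets L [set: H]|.
      have idx (K : {group H}) : #|rcosets K [set: H]| = #|[set: H]| %/ #|K|.
        by rewrite (divgS (subsetT K)).
      by rewrite !idx eLM.
    by rewrite -cardE eI cardE index_mem.
  have := mem_nth set0 lt_i; rewrite mem_enum => /rcosetsP[z _ zE].
  have -> : rk L x = rk M z by rewrite [RHS]/rk -zE index_uniq ?enum_uniq.
  exact: card_rk.
by exists f, f => x y; rewrite -!rk_eq !fE.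
Qed.

(** As 1 lies in S, the vertices over <S> form the connected component of the identity; its image
    stays in the component of the identity for T. *)
Lemma haar_map_gen S T (f1 f2 : {perm H}) :
    1 \in S -> 1 \in T -> f1 1 = 1 ->
    (forall x y, (y * x^-1 \in S) = (f2 y * (f1 x)^-1 \in T)) ->
  f1 @: <<S>> \subset <<T>> /\ f2 @: <<S>> \subset <<T>>.
Proof.
move=> S1 T1 f11 E.
have E1 x : f2 x * (f1 x)^-1 \in <<T>> by rewrite mem_gen // -E mulgV.
have f12 x : (f2 x \in <<T>>) = (f1 x \in <<T>>).
  by rewrite -[f2 x](mulgKV (f1 x)) groupMl.
have f1S x : x \in <<S>> -> f1 x \in <<T>>.
  case/gen_prodgP=> n [c cS ->{x}].
  elim: n c cS => [|n IHn] c cS; first by rewrite big_ord0 f11.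
  rewrite big_ord_recl; set z := \prod_(i < n) _.
  have zT : f1 z \in <<T>> by apply: IHn => i; apply: cS.
  rewrite -f12 -[f2 _](mulgKV (f1 z)) groupM // mem_gen // -E mulgK; exact: cS.
split; apply/subsetP=> _ /imsetP[x xS ->]; first exact: f1S.
by rewrite f12 f1S.
Qed.

Lemma haar_iso_gen S T : 1 \in S -> 1 \in T -> haar_iso S T ->
   exists f1 f2 : {perm H}, [/\
    forall x y, (y * x^-1 \in S) = (f2 y * (f1 x)^-1 \in T),
    f1 @: <<S>> = <<T>> & f2 @: <<S>> = <<T>>].
Proof.
move=> S1 T1 [h1 [h2 E0]].
(* Right translation by h1(1)^-1 is an automorphism of BCay(T), so f1 may be taken to fix 1. *)
have i (h : {perm H}) : injective (fun x => h x * (h1 1)^-1).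
  by move=> x y /mulIg/perm_inj.
pose f1 := perm (i h1); pose f2 := perm (i h2).
have E x y : (y * x^-1 \in S) = (f2 y * (f1 x)^-1 \in T).
  by rewrite E0 !permE invMg invgK mulgA mulgKV.
have f11 : f1 1 = 1 by rewrite permE mulgV.
have E' x y : (y * x^-1 \in T) = (f2^-1 y * (f1^-1 x)^-1 \in S).
  by rewrite E !permKV.
have f11' : f1^-1 1 = 1 by rewrite -{1}f11 permK.
have [s1 s2] := haar_map_gen S1 T1 f11 E.
have [t1 t2] := haar_map_gen T1 S1 f11' E'.
have le_TS : #|<<T>>| <= #|<<S>>|.
  by rewrite -(card_imset _ (@perm_inj _ f1^-1)) subset_leq_card.
exists f1, f2; split=> //; apply/eqP; rewrite eqEcard ?s1 ?s2.
  by rewrite (card_imset _ (@perm_inj _ f1)).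
by rewrite (card_imset _ (@perm_inj _ f2)).
Qed.

Lemma haar_iso_subg S T L : 1 \in S -> 1 \in T -> <<S>> = L -> <<T>> = L ->
  haar_iso S T -> @haar_iso (subg_of L) (sgval @^-1: S) (sgval @^-1: T).
Proof.
move=> S1 T1 SL TL /(haar_iso_gen S1 T1)[f1 [f2 [E e1 e2]]].
have fL (f : {perm H}) (u : subg_of L) : f @: <<S>> = <<T>> -> f (sgval u) \in L.
  by rewrite SL TL => <-; apply: imset_f; apply: subgP.
have i (f : {perm H}) : f @: <<S>> = <<T>> -> injective (fun u : subg_of L => subg L (f (sgval u))).
  move=> fST u v /(congr1 sgval); rewrite !subgK ?fL // => /perm_inj.
  exact: (can_inj sgvalK).
exists (perm (i f1 e1)), (perm (i f2 e2)) => u v.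
rewrite !permE !inE.
have sgM (w w' : subg_of L) : sgval (w * w'^-1) = sgval w * (sgval w')^-1 by [].
by rewrite !sgM E !subgK ?fL.
Qed.

End HaarIso.

Lemma isog_morph_perm (G : finGroupType) (a : {perm G}) (L : {group G}) :
  {morph a : x y / x * y} -> exists2 M : {group G}, a @: L = M & L \isog M.
Proof.
move=> aM; pose am : {morphism L >-> G} := Morphism (in2W aM).
have ai : 'injm am by apply/injmP=> x y _ _ /perm_inj.
exists (am @* L)%G; first by rewrite /= morphimEdom.
exact: sub_isog (subxx L) ai.
Qed.

(** * Non-abelian K2PCI-groups *)

Section Haar.

Variable G : finGroupType.
Hypothesis haar_affine : forall S T : {set G}, haar_iso S T -> affine_equiv S T.
Implicit Types (L M U : {group G}) (a b g x y : G).

Lemma same_order_isog L M : #|L| = #|M| -> L \isog M.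
Proof.
move=> eLM; have [g [a [aM ME]]] := haar_affine (haar_iso_subgroup eLM).
have [K aL iLK] := isog_morph_perm L aM.
have gM : g \in M by rewrite ME; apply/imsetP; exists 1; rewrite ?morph_perm1 ?mulg1.
suff -> : M = K by [].
apply/val_inj=> /=; rewrite -aL; apply/eqP; rewrite eq_sym eqEcard.
rewrite (card_imset _ (@perm_inj _ a)) eLM leqnn andbT; apply/subsetP=> _ /imsetP[x xL ->].
by rewrite -(groupMl _ gM) ME; apply/imsetP; exists x.
Qed.

(** Rank 2 gives an elementary abelian subgroup of order p^2; an element of order above p gives a
    cyclic one of the same order, and these are not isomorphic. *)
Lemma p_rank2_exponent (p : nat) (P : {group G}) :
  p.-group P -> 1 < 'r_p(P) -> {in P, forall x, x ^+ p = 1}.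
Proof.
move=> pP /p_rank_geP[E EP2] x xP; apply/eqP/negPn/negP=> xp.
have pr_p := pnElem_prime EP2.
have [sEP abE cE] := pnElemPcard EP2.
have [n ox] := p_natP (mem_p_elt pP xP).
have n1 : 1 < n.
  rewrite ltnNge; apply: contraNN xp => n1.
  by rewrite -order_dvdn ox -[p in _ %| p]expn1 dvdn_exp2l.
have oy : #[x ^+ (p ^ (n - 2))] = (p ^ 2)%N by rewrite (orderXexp _ ox) subKn.
have /isog_cyclic : E \isog <[x ^+ (p ^ (n - 2))]>%G.
  by apply: same_order_isog; rewrite cE -oy.
by rewrite cycle_cyclic (abelem_cyclic abE) cE pfactorK.
Qed.

(** A normal subgroup of order p in a p-group meets the centre, hence is central. *)
Lemma commute_order_p (p : nat) (P : {group G}) x y :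
  p.-group P -> P \subset 'N(<[x]>) -> x \in P -> y \in P -> x ^+ p = 1 -> commute x y.
Proof.
move=> pP nxP xP yP xp1.
have [->|x1] := eqVneq x 1; first exact/commute_sym/commute1.
have [||pr_p _ _] := @pgroup_pdiv _ p <[x]>; first exact: mem_p_elt pP xP.
  by rewrite cycle_eq1.
have ox : #[x] = p.
  have : #[x] %| p by rewrite order_dvdn xp1.
  by move/(prime_nt_dvdP pr_p) => -> //; rewrite order_eq1.
have nsX : <[x]> <| P by rewrite /normal cycle_subG xP.
have : <[x]> :&: 'Z(P) != 1.
  by rewrite meet_center_nil ?(pgroup_nil pP) // cycle_eq1.
move/prime_meetG; rewrite -[#|_|]/#[x] ox => /(_ pr_p).
by rewrite cycle_subG => /setIP[_ /centP/(_ y yP)].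
Qed.

(* For b outside U, apply the hypothesis to U u bU: its inverse U u U b^-1 is
   then a translate of V u a(b)V with V = a(U), so U V lies in U u U b^-1 and
   |V : V n U| <= 2; V has odd order, hence V = U. *)
Lemma odd_subgroup_normal (hV : forall S : {set G}, affine_equiv S S^-1) U :
  odd #|U| -> U <| [set: G].
Proof.
move=> oddU; rewrite /normal subsetT /=; apply/subsetP=> b _.
have [bU|bU] := boolP (b \in U); first by rewrite (subsetP (normG U)).
have [g [a [aM SE]]] := hV (U :|: b *: U).
have {}SE x : (x^-1 \in U :|: b *: U) = (a^-1 (g^-1 * x) \in U :|: b *: U).
  rewrite -mem_invg SE; apply/imsetP/idP=> [[s sS ->]|xS].
    by rewrite mulKg permK.
  by exists (a^-1 (g^-1 * x)); rewrite // permKV mulKVg.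
have SbU x u : u \in U -> (x * u \in U :|: b *: U) = (x \in U :|: b *: U).
  by move=> uU; rewrite !inE !mem_lcoset mulgA !(groupMr _ uU).
have aVM : {morph a^-1 : x y / x * y}.
  by move=> x y; apply: (@perm_inj _ a); rewrite aM !permKV.
have [V aUV _] := isog_morph_perm U aM.
have UV : U * V \subset U :|: U :* b^-1.
  apply/subsetP=> _ /mulsgP[u v uU vV ->].
  suff: (u * v)^-1 \in U :|: b *: U.
    by rewrite !inE groupV mem_lcoset mem_rcoset invgK -invMg groupV.
  rewrite SE mulgA; move: vV; rewrite -aUV => /imsetP[w wU ->].
  by rewrite aVM permK SbU // -SE inE groupV uU.
have oddV : odd #|V| by rewrite -aUV (card_imset _ (@perm_inj _ a)).
have VU : V \subset U.
  have le2 : #|U * V| <= 2 * #|U|.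
    apply: leq_trans (subset_leq_card UV) _.
    by rewrite (leq_trans (leq_card_setU _ _)) // card_rcoset mul2n addnn.
  rewrite -indexg_eq1 -indexgI.
  have odd_i : odd #|V : V :&: U| by apply: dvdn_odd oddV; rewrite dvdn_indexg.
  have : #|V : V :&: U| <= 2.
    rewrite -(leq_pmul2l (cardG_gt0 (V :&: U))) Lagrange ?subsetIl //.
    rewrite -(leq_pmul2l (cardG_gt0 U)) mul_cardG setIC mulnC.
    by rewrite mulnCA leq_mul2l [X in _ <= X]mulnC le2 orbT.
  by case: #|_ : _| odd_i (indexg_gt0 V (V :&: U)) => [|[|[|]]].
have eVU : V = U.
  by apply/val_inj/eqP; rewrite eqEcard VU /= -aUV (card_imset _ (@perm_inj _ a)) leqnn.
rewrite inE; apply/subsetP=> _ /imsetP[u uU ->].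
have : (b^-1 * u)^-1 \in U :|: b *: U.
  have: u \in V by rewrite eVU.
  rewrite -aUV => /imsetP[w wU ->].
  by rewrite SE mulgA aVM permK SbU // -SE invgK !inE mem_lcoset mulVg group1 orbT.
rewrite !inE groupV mem_lcoset groupMr ?groupV // (negPf bU) /=.
by rewrite invMg invgK -conjgE conjVg groupV.
Qed.

Lemma char_morph_perm (N : {group G}) (a : {perm G}) x :
  {morph a : x y / x * y} -> N \char [set: G] -> (a x \in N) = (x \in N).
Proof.
move=> aM chN; pose am : {morphism [set: G] >-> G} := Morphism (in2W aM).
have ai : 'injm am by apply/injmP=> u v _ _ /perm_inj.
have aT : am @* [set: G] = [set: G].
  by rewrite /= morphimEdom; apply/setP=> u; rewrite inE -[u](permKV a) imset_f ?inE.
have /charP[_ /(_ am ai aT) aN] := chN.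
by rewrite -{1}aN morphimE setTI (mem_imset _ _ (@perm_inj _ a)).
Qed.

(* Apply the hypothesis to X u bX and compare the parts inside and outside N. *)
Lemma conj_translate (hV : forall S : {set G}, affine_equiv S S^-1)
    (N : {group G}) (X : {set G}) b :
    N \char [set: G] -> X \subset N -> 1 \in X -> b \notin N ->
    abelian <<X>> -> b \in 'N(<<X>>) ->
  exists2 m, m \in <<X>> & X :^ b^-1 = m *: X.
Proof.
move=> chN XN X1 bN abX nXb.
have [g [a [aM SE]]] := hV (X :|: b *: X).
have aN x := char_morph_perm x aM chN.
have cardM c : #|c *: (a @: X)| = #|X^-1|.
  by rewrite card_lcoset card_invg (card_imset _ (@perm_inj _ a)).
have {}SE : X^-1 :|: X^-1 :* b^-1 = g *: (a @: X) :|: (g * a b) *: (a @: X).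
  transitivity (X :|: b *: X)^-1.
    by apply/setP=> x; rewrite !inE mem_lcoset mem_rcoset inE invMg invgK.
  have fE (Y : {set G}) : [set g * a x | x in Y] = g *: (a @: Y).
    by rewrite (imset_comp (mulg g) a) -lcosetE.
  rewrite SE fE imsetU lcosetM -mulgU; congr (_ *: (_ :|: _)).
  apply/setP=> x; rewrite mem_lcoset; apply/imsetP/imsetP=> -[y].
    rewrite mem_lcoset => yX ->; exists (b^-1 * y) => //.
    by rewrite aM morph_permV.
  move=> yX xE; exists (b * y); first by rewrite mem_lcoset mulKg.
  by rewrite aM -xE mulKVg.
have XiN : X^-1 \subset N by rewrite -(invGid N) invSg.
have XbN x : x \in X^-1 :* b^-1 -> x \notin N.
  rewrite mem_rcoset invgK => /(subsetP XiN) xbN; apply: contra bN => xN.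
  by rewrite -(groupMl _ xN).
have gaN c x : x \in c *: (a @: X) -> (x \in N) = (c \in N).
  case/lcosetP=> _ /imsetP[y yX ->] ->.
  by rewrite groupMr // aN (subsetP XN).
have abN : a b \notin N by rewrite aN.
(* The position of g relative to N decides which translate is X^-1. The index of N may exceed 2, so
   for g outside N the position of g a(b) is not known in advance; each inclusion is proved in the
   direction available, and equal cardinalities make it an equality. *)
have [c [d [cX dX]]] : exists c d, c *: (a @: X) = X^-1 /\ d *: (a @: X) = X^-1 :* b^-1.
  have eqS c (Y : {set G}) : #|Y| = #|X^-1| -> (c *: (a @: X) \subset Y) || (Y \subset c *: (a @: X)) ->
      c *: (a @: X) = Y.
    move=> cY /orP[] s; apply/eqP; first by rewrite eqEcard s cardM cY leqnn.
    by rewrite eq_sym eqEcard s cardM cY leqnn.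
  have [gN|gN] := boolP (g \in N).
    exists g, (g * a b); split; apply: eqS; rewrite ?card_rcoset //; apply/orP.
      left; apply/subsetP=> x xg; have := gaN _ _ xg; rewrite gN => xN.
      have: x \in X^-1 :|: X^-1 :* b^-1 by rewrite SE inE xg.
      by rewrite inE => /orP[//|/XbN]; rewrite xN.
    right; apply/subsetP=> x xb; have /negP := XbN _ xb.
    have: x \in g *: (a @: X) :|: (g * a b) *: (a @: X) by rewrite -SE inE xb orbT.
    by rewrite inE => /orP[/gaN->|//]; rewrite gN.
  exists (g * a b), g; split; apply: eqS; rewrite ?card_rcoset //; apply/orP.
    right; apply/subsetP=> x xX; have xN := subsetP XiN _ xX.
    have: x \in g *: (a @: X) :|: (g * a b) *: (a @: X) by rewrite -SE inE xX.
    by rewrite inE => /orP[/gaN|//]; rewrite xN (negPf gN).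
  left; apply/subsetP=> x xg; have := gaN _ _ xg; rewrite (negPf gN) => xN.
  have: x \in X^-1 :|: X^-1 :* b^-1 by rewrite SE inE xg.
  by rewrite inE => /orP[/(subsetP XiN)|//]; rewrite xN.
have {dX}eX : (d * c^-1) *: X^-1 = X^-1 :* b^-1 by rewrite -dX -cX -lcosetM mulgKV.
pose e := b * (d * c^-1).
have XV : X^-1 :^ b^-1 = e *: X^-1.
  by rewrite conjsgE invgK -eX -lcosetM.
have X1V : 1 \in X^-1 by rewrite inE invg1.
have gX x : x \in X^-1 -> x \in <<X>>.
  by rewrite inE => xX; rewrite -groupV mem_gen.
have eM : e \in <<X>>.
  have: e \in X^-1 :^ b^-1 by rewrite XV mem_lcoset mulVg.
  rewrite mem_conjgV => /gX eb.
  by rewrite -(memJ_norm _ nXb).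
exists e^-1; first by rewrite groupV.
apply/setP=> x; rewrite mem_conjg invgK mem_lcoset invgK.
have -> : (x ^ b \in X) = (x^-1 \in X^-1 :^ b^-1).
  by rewrite mem_conjg invgK conjVg inE invgK.
rewrite XV mem_lcoset inE invMg !invgK.
(* Inversion has turned a left translate into a right one. The two agree inside the abelian <X>, and
   outside it both memberships fail. *)
have [xX|xX] := boolP (x \in <<X>>); first by rewrite (centsP abX _ xX).
transitivity false; first apply/negP=> /(mem_gen).
  by rewrite (groupMr _ eM) (negPf xX).
by apply/esym/negP=> /mem_gen; rewrite (groupMl _ eM) (negPf xX).
Qed.

End Haar.

(** * The subgroup A of elements of odd order and the dihedral groups *)

Section NonAbelian.

Variable G : finGroupType.
Hypothesis haar_affine : forall S T : {set G}, haar_iso S T -> affine_equiv S T.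
Hypothesis invg_affine : forall S : {set G}, affine_equiv S S^-1.
Implicit Types (L M U : {group G}) (a b g x y : G).

Local Notation A := 'O_2^'([set: G]).

Lemma mem_odd_core x : (x \in A) = odd #[x].
Proof.
apply/idP/idP => [xA|ox]; first by rewrite odd_2'nat; apply: mem_p_elt xA; apply: pcore_pgroup.
rewrite -cycle_subG pcore_max //; first by rewrite /pgroup -odd_2'nat.
exact: odd_subgroup_normal.
Qed.

Lemma odd_core_odd : odd #|A|.
Proof. by rewrite odd_2'nat; apply: pcore_pgroup. Qed.

(** In rank 1 an odd p-group is cyclic. Otherwise every nontrivial element has order p and generates
    a normal, hence central, subgroup. *)
Lemma odd_pgroup_abelian (p : nat) (P : {group G}) : p.-group P -> odd #|P| -> abelian P.
Proof.
move=> pP oddP; have [r1|r2] := leqP 'r_p(P) 1.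
  by apply: cyclic_abelian; rewrite (odd_pgroup_rank1_cyclic pP).
apply/centsP=> x xP y yP; apply: (commute_order_p pP) => //; last first.
  exact: (p_rank2_exponent haar_affine pP r2).
apply: subset_trans (subsetT _) (normal_norm _).
by apply: odd_subgroup_normal => //; apply: dvdn_odd oddP; apply: order_dvdG.
Qed.

(** Sylow subgroups of A are normal in G: for equal primes they coincide and are abelian, for
    distinct primes their commutator lies in their trivial intersection. *)
Lemma odd_core_abelian : abelian A.
Proof.
have nA (P : {group G}) : P \subset A -> P <| [set: G].
  by move=> PA; apply: odd_subgroup_normal => //; apply: dvdn_odd (cardSg PA) odd_core_odd.
rewrite /abelian -{1}(Sylow_gen A) gen_subG; apply/bigcupsP=> P /SylowP[p pr_p sylP].
change (P \subset 'C(A)); rewrite centsC -{1}(Sylow_gen A) gen_subG; apply/bigcupsP=> Q /SylowP[q pr_q sylQ].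
have PA := pHall_sub sylP; have QA := pHall_sub sylQ.
have [nP nQ] := (nA _ PA, nA _ QA).
have [epq|npq] := eqVneq p q.
  rewrite -epq in sylQ.
  rewrite -(normal_Hall_pcore sylQ) ?(normalS _ _ nQ) ?subsetT //.
  rewrite (normal_Hall_pcore sylP) ?(normalS _ _ nP) ?subsetT //.
  apply: (@odd_pgroup_abelian p); first exact: pHall_pgroup sylP.
  exact: dvdn_odd (cardSg PA) odd_core_odd.
apply/commG1P/trivgP.
have <- : Q :&: P = 1.
  apply: coprime_TIg; apply: pnat_coprime (pHall_pgroup sylQ) _.
  apply: sub_in_pnat (pHall_pgroup sylP) => r _ /eqnP->.
  by rewrite !inE.
rewrite subsetI commg_subl commg_subr.
by rewrite (subset_trans (subsetT _) (normal_norm nP)) (subset_trans (subsetT _) (normal_norm nQ)).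
Qed.

Lemma odd_core_translate (X : {set G}) b : b \notin A -> X \subset A -> 1 \in X ->
  exists m, X :^ b = m *: X.
Proof.
move=> bA XA X1.
have sXA : <<X>> \subset A by rewrite gen_subG.
have [||||||m _] := @conj_translate _ invg_affine 'O_2^'([set: G])%G X b^-1.
- exact: pcore_char.
- by [].
- by [].
- by rewrite groupV.
- exact: abelianS sXA odd_core_abelian.
- have nX : <<X>> <| [set: G].
    by apply: odd_subgroup_normal => //; exact: dvdn_odd (cardSg sXA) odd_core_odd.
  by rewrite groupV; apply: subsetP (normal_norm nX) _ _.
by rewrite invgK => E; exists m.
Qed.

Lemma translateP (X : {set G}) b m x : X :^ b = m *: X -> x \in X -> m^-1 * x ^ b \in X.
Proof. by move=> E xX; rewrite -mem_lcoset -E memJ_conjg. Qed.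

Lemma odd_sqr1 x : x \in A -> x * x = 1 -> x = 1.
Proof.
rewrite mem_odd_core -expg2 => ox /eqP; rewrite -order_dvdn => d2; apply/eqP; rewrite -order_eq1.
by move: (dvdn_leq (isT : 0 < 2) d2) ox (order_gt0 x); case: #[x] => [|[|[|]]].
Qed.

(** {1, x^b} = m {1, x} forces m^-1 = 1 or m^-1 = x; these give x^b = x and x^b = x^-1. *)
Lemma odd_core_pair x b : b \notin A -> x \in A -> x ^ b = x \/ x ^ b = x^-1.
Proof.
move=> bA xA.
have [||m E] := @odd_core_translate [set 1; x] b bA.
- by apply/subsetP=> y; rewrite !inE => /orP[]/eqP-> //; apply: group1.
- by rewrite !inE eqxx.
have x1 : x ^ b = 1 -> x = 1 by move/eqP; rewrite conjg_eq1 => /eqP.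
have := translateP E (set21 _ _); have := translateP E (set22 _ _).
rewrite conj1g mulg1 !inE => + /orP[]/eqP mE; rewrite mE ?mul1g.
  by case/orP=> /eqP e; [have := x1 e => ex; left; rewrite e ex| left].
case/orP => /eqP e; first by right; apply: (mulgI x); rewrite e mulgV.
by left; have := mulgI _ _ _ (etrans e (esym (mulg1 x))) => e1; rewrite e1 (x1 e1).
Qed.

(** If b inverts a and fixes x, then (xa)^b = x a^-1 equals xa or its inverse, so a^2 = 1 or x^2 =
    1. In odd order only x = 1 survives. *)
Lemma odd_core_inverted a b : a \in A -> b \notin A -> a ^ b != a ->
  {in A, forall x, x ^ b = x^-1}.
Proof.
move=> aA bA ab x xA.
have abV : a ^ b = a^-1 by case: (odd_core_pair bA aA) => // e; rewrite e eqxx in ab.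
have a1 : a * a != 1.
  by apply: contraNneq ab => /(odd_sqr1 aA) ->; rewrite conj1g.
case: (odd_core_pair bA xA) => // xb.
have cxa := centsP odd_core_abelian _ xA _ aA.
case: (odd_core_pair bA (groupM xA aA)); rewrite conjMg xb abV.
  by move/mulgI/eqP; rewrite eq_invg_mul (negPf a1).
rewrite cxa invMg => /mulIg/eqP; rewrite eq_sym eq_invg_mul => /eqP/(odd_sqr1 xA) ->.
by rewrite invg1.
Qed.

(** Conjugation by b inverts X = {1, a, y}, so {1, a^-1, y^-1} = m X. For m^-1 = 1, a, y this gives
    y = a^-1, y^2 = a, y = a^2. The square root of a in a group of odd order is a^((|A|+1)/2),
    whence five candidates for y. *)
Lemma odd_core_card a b : a \in A -> b \notin A -> a ^ b != a -> #|A| = 3 \/ #|A| = 5.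
Proof.
move=> aA bA ab; have inv := odd_core_inverted aA bA ab.
have a1 : a != 1 by apply: contraNneq ab => ->; rewrite conj1g.
have a2 : a * a != 1 by apply: contraNneq a1 => /(odd_sqr1 aA) ->.
have aV : a^-1 != a by rewrite eq_invg_mul.
have sub y : y \in A -> y \in [:: 1; a; a^-1; a * a; a ^+ (#|A|.+1)./2].
  move=> yA; rewrite !inE.
  have [//|y1] := eqVneq y 1; have [//|ya] := eqVneq y a.
  have [||m E] := @odd_core_translate [set 1; a; y] b bA.
  - apply/subsetP=> z; rewrite !inE => /orP[/orP[]|]/eqP-> //; exact: group1.
  - by rewrite !inE eqxx.
  have := translateP E (_ : 1 \in _); have := translateP E (_ : a \in _).
  have := translateP E (_ : y \in _).
  rewrite !inE !eqxx !orbT /= => /(_ isT) + /(_ isT) + /(_ isT).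
  rewrite conj1g mulg1 !inv // => hy ha /orP[/orP[]|]/eqP mE; move: hy ha; rewrite mE.
  - rewrite !mul1g => _; rewrite invg_eq1 (negPf a1) (negPf aV) /= eq_sym => /eqP->.
    by rewrite eqxx ?orbT.
  - rewrite -eq_mulgV1 eq_sym (negPf ya) /= => /orP[]/eqP e _.
      by case/eqP: y1; apply: invg_inj; apply: (mulgI a); rewrite e invg1 mulg1.
    have ayy : a = y * y by rewrite -{1}e mulgKV.
    have n2 : (2 * uphalf #|A|)%N = #|A|.+1.
      by rewrite mul2n uphalf_half odd_core_odd doubleD -[RHS](odd_double_half #|A|.+1) /=
           odd_core_odd /= uphalf_half odd_core_odd doubleD.
    have -> : (y == a ^+ uphalf #|A|).
      by rewrite ayy -expg2 -expgM n2 expgS expg_cardG // mulg1.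
    by rewrite !orbT.
  move=> _; rewrite -eq_mulgV1 (negPf ya) /= => /orP[]/eqP e.
    by have -> : y = a * a by [rewrite -{1}e mulgKV]; rewrite eqxx ?orbT.
  by case/eqP: a1; apply: invg_inj; apply: (mulgI y); rewrite e invg1 mulg1.
have le5 : #|A| <= 5.
  have := subset_leq_card (introT subsetP sub).
  by move/leq_trans; apply; apply: card_size.
have := odd_core_odd; move: le5.
have : 1 < #|A|.
  by rewrite cardG_gt1; apply: contraNneq a1 => A1; rewrite A1 inE in aA.
by case: #|A| => [|[|[|[|[|[|]]]]]] //; [left | right].
Qed.

(** If C(A) had even order, a Sylow 2-subgroup containing c would have a central element z <> 1 in
    C(A). Then {1, a, z}^c = {1, a^-1, z} would be a translate of {1, a, z}, which fails for each of
    the three translations. So C(A) is normal of odd order. *)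
Lemma odd_core_self_centralizing a c : a \in A -> c \notin A -> 2.-elt c -> a ^ c != a -> 'C(A) \subset A.
Proof.
move=> aA cA c2 ac; have inv := odd_core_inverted aA cA ac.
have a1 : a != 1 by apply: contraNneq ac => ->; rewrite conj1g.
have a2 : a * a != 1 by apply: contraNneq a1 => /(odd_sqr1 aA) ->.
have aV : a^-1 != a by rewrite eq_invg_mul.
have chN : 'C_[set: G](A) \char [set: G].
  by apply: subcent_char; rewrite ?char_refl ?pcore_char.
have nsN := char_normal chN.
have [Q sylQ cQ] := Sylow_superset (subsetT <[c]>) c2.
rewrite cycle_subG in cQ.
have sylQN := Hall_setI_normal nsN sylQ.
have [QN1|QN1] := eqVneq (Q :&: 'C_[set: G](A)) 1.
  rewrite -['C(A)]setTI pcore_max // /pgroup.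
  by case/and3P: sylQN => _ _; rewrite /= QN1 indexg1.
have nQN : Q :&: 'C_[set: G](A) <| Q.
  by rewrite /normal subsetIl normsI ?normG // (subset_trans (subsetT Q)) ?normal_norm.
have /trivgPn[z] := meet_center_nil (pgroup_nil (pHall_pgroup sylQ)) nQN QN1.
rewrite !inE /= => /andP[/andP[zQ zN] /andP[_ zZ]] z1.
have zA : z \notin A.
  rewrite mem_odd_core; apply: contraNN z1 => oz.
  have : 2.-elt z by apply: mem_p_elt (pHall_pgroup sylQ) zQ.
  rewrite -order_eq1 => /p_natP[n en]; move: oz; rewrite en oddX orbF.
  by case: n {en}.
have zc : z ^ c = z by apply/conjg_fixP/commgP/(centP zZ).
have za : commute z a by apply: (centP zN).
pose X := [set 1; a; z].
have aX : a \in <<X>> by rewrite mem_gen // !inE eqxx orbT.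
have zX : z \in <<X>> by rewrite mem_gen // !inE eqxx !orbT.
have [||||||m _] := @conj_translate _ invg_affine [group of 'C_[set: G](A)] X c^-1.
- by [].
- apply/subsetP=> x; rewrite !inE => /orP[/orP[]|]/eqP->; rewrite ?group1 //.
  by apply: (subsetP odd_core_abelian).
- by rewrite !inE eqxx.
- rewrite groupV inE /= inE /=; apply: contraNN ac => /centP/(_ a aA) e.
  by apply/eqP/conjg_fixP/commgP/commute_sym.
- rewrite abelian_gen; apply/centsP=> x xX y yX.
  move: xX yX; rewrite !inE => /orP[/orP[]|]/eqP-> /orP[/orP[]|]/eqP->;
    rewrite /commute ?mulg1 ?mul1g //.
- rewrite groupV inE -genJ gen_subG; apply/subsetP=> _ /imsetP[x + ->].
  rewrite !inE => /orP[/orP[]|]/eqP->; rewrite ?conj1g ?zc ?inv //.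
  by rewrite groupV.
rewrite invgK => E.
have := translateP E (_ : 1 \in _); have := translateP E (_ : a \in _).
have := translateP E (_ : z \in _).
rewrite !inE !eqxx !orbT /= => /(_ isT) + /(_ isT) + /(_ isT).
have nza x : x \in A -> (x == z) = false.
  by move=> xA; apply: contraNF zA => /eqP<-.
rewrite conj1g mulg1 (inv a aA) zc => hz ha /orP[/orP[]|]/eqP mE; move: hz ha; rewrite mE.
- by rewrite !mul1g invg_eq1 (negPf a1) (negPf aV) (nza a^-1) ?groupV //=.
- have -> : (a * z == a) = false.
    by rewrite -{2}[a]mulg1 (inj_eq (mulgI a)) (negPf z1).
  have -> : (a * z == z) = false.
    by rewrite -{2}[z]mul1g (inj_eq (mulIg z)) (negPf a1).
  rewrite !orbF.
  by rewrite -eq_invg_mul (nza a^-1) ?groupV.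
move=> _; rewrite -(eq_mulgV1 z) eq_sym nza // (_ : (z * a^-1 == z) = false) ?orbF /=; last first.
  by rewrite -{2}[z]mulg1 (inj_eq (mulgI z)) invg_eq1 (negPf a1).
move=> /eqP e; have: a * a = z by rewrite -{1}e mulgKV.
by move/eqP; rewrite nza // groupM.
Qed.

(** As C(A) lies in A, every element outside A inverts A. Two such elements differ by an element of
    C(A), so |G : A| = 2; the square of one is both fixed and inverted by it, so it is an
    involution. Then c and ca generate a dihedral group. *)
Lemma odd_core_noncentral : ~~ (A \subset 'Z([set: G])) ->
  [set: G] \isog 'D_6 \/ [set: G] \isog 'D_10.
Proof.
case/subsetPn=> a aA; rewrite inE in_setT /= => aZ.
have /existsP[b ab] : [exists b, a ^ b != a].
  apply: contraNT aZ; rewrite negb_exists => /forallP ab; apply/centP=> b _.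
  by apply/commgP/conjg_fixP/eqP/negPn/ab.
have cA x : x \in A -> a ^ x = a.
  by move=> xA; apply/conjg_fixP/commgP/(centsP odd_core_abelian).
(* The odd part of b lies in the abelian A and fixes a, so the 2-part already moves a. *)
pose c := b.`_2.
have b'A : b.`_2^' \in A.
  by rewrite mem_odd_core odd_2'nat; apply: p_elt_constt.
have ac : a ^ c != a.
  apply: contraNneq ab => e.
  by rewrite -(consttC 2 b) conjgM e cA.
have c2 : 2.-elt c by apply: p_elt_constt.
have ncA : c \notin A by apply: contraNN ac => /cA->.
have CA := odd_core_self_centralizing aA ncA c2 ac.
have inv g : g \notin A -> {in A, forall x, x ^ g = x^-1}.
  move=> gA; have: g \notin 'C(A) by apply: contraNN gA; apply: subsetP.
  case: (altP (@exists_inP _ (mem A) (fun x => x ^ g != x))) => [[x xA xg] _|].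
    exact: odd_core_inverted xA gA xg.
  rewrite negb_exists_in => /forall_inP h /negP[]; apply/centP=> x xA.
  by apply/commute_sym/commgP/conjg_fixP/eqP/negPn/h.
have sqr g : g \notin A -> #[g] = 2.
  move=> gA; have ggA : g * g \in A.
    apply: (subsetP CA); apply/centP=> x xA; apply/commute_sym/commgP/conjg_fixP.
    by rewrite conjgM !inv ?groupV // invgK.
  apply: nt_prime_order => //; last by apply: contraNneq gA => ->.
  apply: odd_sqr1; rewrite expg2 //.
  have e : (g * g) ^ g = g * g by apply/conjg_fixP/commgP; rewrite /commute mulgA.
  by rewrite -{1}e inv // mulVg.
have GE : [set: G] = A :|: A :* c.
  apply/setP=> g; rewrite !inE mem_rcoset; apply/esym.
  have [//|gA] := boolP (g \in A); apply: (subsetP CA).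
  apply/centP=> x xA; apply/commute_sym/commgP/conjg_fixP.
  by rewrite conjgM !inv ?groupV // invgK.
have caA : c * a \notin A by rewrite groupMr.
have c_ca : c != c * a.
  by rewrite -{1}[c]mulg1 (inj_eq (mulgI c)) eq_sym; apply: contraNneq ac => ->; rewrite conj1g.
have := involutions_gen_dihedral (sqr c ncA) (sqr _ caA) c_ca.
have cardA := odd_core_card aA ncA ac.
have genA : <[a]> = A.
  apply/eqP; rewrite eqEcard cycle_subG aA /=.
  have pA : prime #|A| by case: cardA => ->.
  have : #|<[a]>| %| #|A| by apply: cardSg; rewrite cycle_subG.
  case/primeP: pA => _ h /h/orP[]; last by move/eqP->.
  rewrite -[#|_|]/#[a] order_eq1 => /eqP a1; case/eqP: ac; by rewrite a1 conj1g.
pose K := [group of <<[set c; c * a]>>].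
have KG : <<[set c; c * a]>> = [set: G].
  apply/eqP; rewrite eqEsubset subsetT GE -[<<_>>]/(gval K).
  have cK : c \in K by rewrite mem_gen // !inE eqxx.
  have AK : A \subset K.
    rewrite -genA cycle_subG -(groupMl _ cK) mem_gen // !inE eqxx orbT //.
  rewrite subUset AK; apply/subsetP=> g; rewrite mem_rcoset => /(subsetP AK).
  by rewrite groupMr ?groupV.
have cardG : #|[set: G]| = #|A|.*2.
  transitivity #|A :|: A :* c|; first by rewrite -GE.
  rewrite cardsU card_rcoset addnn (_ : _ :&: _ = set0) ?cards0 ?subn0 //.
  apply/setP=> g; rewrite !inE mem_rcoset; apply/negP=> /andP[gA].
  by rewrite groupMl // groupV (negPf ncA).
rewrite KG cardG.
by case: cardA => -> ?; [left | right].
Qed.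

End NonAbelian.

(** * Central A and the quaternion group *)

Section CentralOddCore.

Variable G : finGroupType.
Hypothesis haar_affine : forall S T : {set G}, haar_iso S T -> affine_equiv S T.
Hypothesis invg_affine : forall S : {set G}, affine_equiv S S^-1.
Local Notation A := 'O_2^'([set: G]).
Hypothesis cA : A \subset 'Z([set: G]).

(** Sylow subgroups for odd primes are normal, hence in A; so |G : A| is a power of 2 while |G : Q|
    is odd. *)
Lemma odd_core_mul_Sylow (Q : {group G}) : 2.-Sylow([set: G]) Q -> A <*> Q = [set: G].
Proof.
move=> sylQ; apply/eqP; rewrite eqEsubset subsetT -indexg_eq1.
have iA : 2.-nat #|[set: G] : A|.
  apply/pnatP=> // q pr_q dq; apply/contraT => q2.
  have [P sylP] := Sylow_exists q [set: G].
  have oddq : odd q by case: (even_prime pr_q) => // e; rewrite e in q2.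
  have PA : P \subset A.
    apply: pcore_max; last first.
      apply: odd_subgroup_normal => //.
      by have [n ->] := p_natP (pHall_pgroup sylP); rewrite oddX oddq orbT.
    apply: sub_in_pnat (pHall_pgroup sylP) => r _ /eqnP->.
    by rewrite !inE.
  have := pHall_pgroup sylP; case/and3P: sylP => _ _ + _.
  rewrite -(Lagrange_index (pcore_sub _ _) PA) pnatM => /andP[+ _].
  by move/pnatP=> /(_ (indexg_gt0 _ _) q pr_q dq); rewrite !inE eqxx.
have d1 : #|[set: G] : A <*> Q| %| #|[set: G] : A| by apply: indexgS; apply: joing_subl.
have d2 : #|[set: G] : A <*> Q| %| #|[set: G] : Q| by apply: indexgS; apply: joing_subr.
have /and3P[_ _ iQ] := sylQ.
by apply/eqP; apply: (@pnat_1 2); [apply: pnat_dvd d1 iA | apply: pnat_dvd d2 iQ].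
Qed.

(** Rank 2 would give exponent 2, hence commutativity. In rank 1, a second involution next to a
    central one is impossible. *)
Lemma Sylow2_unique_involution (Q : {group G}) :
  2.-group Q -> ~~ abelian Q -> #|'Ohm_1(Q)| = 2.
Proof.
move=> pQ nabQ; have r1 : 'r_2(Q) <= 1.
  rewrite leqNgt; apply: contraNN nabQ => r2; apply/abelem_abelian/exponent2_abelem.
  by apply/exponentP; apply: (p_rank2_exponent haar_affine pQ r2).
have Q1 : Q :!=: 1 by apply: contraNneq nabQ => ->; apply: abelian1.
have ZQ1 : 'Z(Q) != 1 by rewrite (center_nil_eq1 (pgroup_nil pQ)).
have pZ : 2.-group 'Z(Q) := pgroupS (center_sub Q) pQ.
have [_ d2 _] := pgroup_pdiv pZ ZQ1.
have [z zZ oz] := Cauchy (isT : prime 2) d2.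
have [zQ zC] := setIP zZ.
suff -> : 'Ohm_1(Q) = <[z]> by rewrite -orderE.
apply/eqP; rewrite eqEsubset; apply/andP; split; last first.
  by rewrite (OhmE 1 pQ) cycle_subG mem_gen // !inE zQ -oz expg_order eqxx.
rewrite (OhmE 1 pQ) gen_subG; apply/subsetP=> x; rewrite !inE => /andP[xQ /eqP x2].
apply: contraLR r1 => xz; rewrite -ltnNge; apply/p_rank_geP.
have x1 : x != 1 by apply: contraNneq xz => ->; apply: group1.
have ox : #[x] = 2 by apply: nt_prime_order.
have tiZX : <[z]> :&: <[x]> = 1.
  rewrite setIC; apply: prime_TIg; first by rewrite -orderE ox.
  by rewrite cycle_subG.
have cZX : <[x]> \subset 'C(<[z]>).
  by rewrite cent_cycle cycle_subG; apply/cent1P/commute_sym/(centP zC).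
exists (<[z]> <*> <[x]>)%G; apply/pnElemP; split.
- by rewrite join_subG !cycle_subG zQ.
- rewrite (dprod_abelem 2 (dprodEY cZX tiZX)).
  by rewrite !prime_abelem -?orderE ?oz ?ox.
by rewrite /= cent_joinEr // TI_cardMg // -!orderE oz ox.
Qed.

(** A non-cyclic 2-group with one involution is generalized quaternion. Beyond order 8 it has a
    cyclic and a quaternion subgroup of index 2, which contradicts [same_order_isog]. *)
Lemma Sylow2_quaternion8 (Q : {group G}) :
  2.-group Q -> ~~ abelian Q -> Q \isog [set: 'Q_8] /\
  exists x y, [/\ pprod <[x]> <[y]> = Q, #[x] = 4, y ^+ 2 = x ^+ 2 & x ^ y = x^-1].
Proof.
move=> pQ nabQ; have Q1 : Q :!=: 1 by apply: contraNneq nabQ => ->; apply: abelian1.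
have := Sylow2_unique_involution pQ nabQ; move/(prime_Ohm1P pQ Q1).
case/orP=> [/cyclic_abelian|]; first by rewrite (negPf nabQ).
case/andP=> _ /eqP/quaternion_classP[n n_gt2 isoQ].
have [[x y] genQ _] := generators_quaternion n_gt2 isoQ.
have [[pQxy o4 inv] _ [_ _ inv2 _ _] _ big] := quaternion_structure n_gt2 genQ isoQ.
case: genQ => oQ xQ ox yQx.
have {big}n3 : n = 3.
  apply/eqP; rewrite eqn_leq n_gt2 andbT leqNgt; apply/negP=> n_gt3.
  have [isoY _ cycU] := big n_gt3.
  have oY : #|<<y ^: Q>>| = (2 ^ n.-1)%N.
    by rewrite (card_isog isoY) card_quaternion // -ltnS prednK // (ltn_trans _ n_gt2).
  have /isog_cyclic : <[x]> \isog <<y ^: Q>>%G.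
    by apply: (same_order_isog haar_affine) => /=; rewrite oY -orderE ox.
  rewrite cycle_cyclic => /esym cycY.
  have YQ : <<y ^: Q>> \subset Q.
    by rewrite gen_subG class_subG ?(subsetP (subsetDl _ _) _ yQx).
  have iY : #|Q : <<y ^: Q>>| = 2.
    rewrite -divgS //= oQ oY -(prednK (ltn_trans (isT : 0 < 2) n_gt2)) expnS mulnK ?expn_gt0 //.
  have Yx := cycU _ cycY YQ iY.
  by case/setDP: yQx => _; rewrite -Yx mem_gen ?class_refl.
subst n; split=> //; exists x, y; split=> //.
  apply: inv2; first by rewrite groupX // (subsetP (subsetDl _ _) _ yQx).
  by rewrite orderXdiv (o4 _ yQx).
by apply: inv yQx; apply: cycle_id.
Qed.

(** Let M = Z(G). If A <> 1, [S] meets M, xM, yM, xyM in 1, 2, |A|, |M|-1 elements, all distinct as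
    |A| >= 3 and |M| >= 2|A|. These cosets are closed under inversion, so S^-1 = g f(S) puts g f(q)
    in qM, and the single point of S in M gives g = 1. The pieces in xM and yM then force f(x) =
    x^-1 and f(y) = y^-1, and the hole at xy contradicts f(xy) = xy. *)
Lemma quaternion8_trivial_odd_core x y : #[x] = 4 -> y ^+ 2 = x ^+ 2 -> x ^ y = x^-1 ->
  (forall w, exists q m, [/\ q \in [:: 1; x; y; x * y], m \in 'Z([set: G]) & w = q * m]) ->
  A = 1.
Proof.
move=> ox yx xy cover; apply/eqP; apply: contraT => /trivgPn[a aA a1].
pose M := 'Z([set: G])%G.
pose S := [set 1; x; x * a] :|: y *: A :|: (x * y) *: (M :\ 1).
have [z zE] : exists z, z = x ^+ 2 by exists (x ^+ 2).
have zz : z * z = 1 by rewrite zE -expgD; apply/eqP; rewrite -order_dvdn ox.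
have aM : a \in M := subsetP cA a aA.
have AM : {subset A <= M} := subsetP cA.
have cM m g : m \in M -> commute m g by case/setIP=> _ /centP; apply; rewrite inE.
have z1 : z != 1 by rewrite zE -order_dvdn ox.
have xyx : x * y = y * x^-1 by rewrite -xy /conjg !mulgA mulgV mul1g.
have xV : x^-1 = x * z.
  by apply: (mulgI x); rewrite mulgV mulgA -expg2 -zE zz.
have yxE : y * x = x * y * z by rewrite xyx xV -!mulgA zz mulg1.
have czx : commute z x by rewrite zE; apply/commute_sym/commuteX.
have czy : commute z y by rewrite zE -yx; apply/commute_sym/commuteX.
have zM : z \in M.
  rewrite inE in_setT; apply/centP=> w _; have [q [m [qs mM ->]]] := cover w.
  apply: commuteM; last by apply/commute_sym/cM.
  move: qs; rewrite !inE => /or4P[]/eqP-> //; first exact: commute1.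
  exact: commuteM.
have nxy : x * y != y * x.
  by rewrite yxE -{1}[x * y]mulg1 (inj_eq (mulgI _)) eq_sym.
have xM : x \notin M by apply: contraNN nxy => /(cM _ y) ->.
have yM : y \notin M by apply: contraNN nxy => /(cM _ x) ->.
have xyM : x * y \notin M.
  by apply: contraNN nxy => /(cM _ x); rewrite /commute -mulgA => /mulgI->.
have yVxM : y^-1 * x \notin M.
  apply: contraNN nxy => /(cM _ y); rewrite /commute mulKVg => e.
  by rewrite -{2}e !mulgA mulgV mul1g.
have xVyM : x^-1 * y \notin M by rewrite -groupV invMg invgK.
have mem_in q m (B : {set G}) : m \in M -> q \notin M -> {subset B <= M} -> (q * m \in B) = false.
  by move=> mM qM BM; apply: contraNF qM => /BM; rewrite groupMr.
have mem_eq q m u : m \in M -> u \in M -> q \notin M -> (q * m == u) = false.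
  by move=> mM uM; apply: contraNF => /eqP e; rewrite -(groupMr q mM) e.
have BM : {subset M :\ 1 <= M} by move=> m /setD1P[].
have memS w : (w \in S) = [|| w == 1, w == x, w == x * a, y^-1 * w \in A | (x * y)^-1 * w \in M :\ 1].
  by rewrite !in_setU !in_set1 !mem_lcoset -!orbA.
have V q : q \notin M -> q^-1 \notin M by rewrite groupV.
have eqV (q w v : G) : (w == q * v) = (q^-1 * w == v).
  by rewrite -{1}[w](mulKVg q) (inj_eq (mulgI q)).
have mem1 m : m \in M -> (m \in S) = (m == 1).
  move=> mM; rewrite memS !mem_in ?V // !orbF eqV -{1}[x]mulg1 eqV.
  by rewrite !mem_eq ?V ?group1 // !orbF.
have memx m : m \in M -> (x * m \in S) = (m \in [set 1; a]).
  move=> mM; rewrite memS.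
  have -> : (y^-1 * (x * m) \in A) = false by rewrite mulgA mem_in.
  have -> : ((x * y)^-1 * (x * m) \in M :\ 1) = false.
    by rewrite mulgA mem_in // invMg mulgKV V.
  rewrite mem_eq ?group1 // -{2}[x]mulg1 !(inj_eq (mulgI x)) !inE //=.
  by rewrite orbF.
have memy m : m \in M -> (y * m \in S) = (m \in A).
  move=> mM; rewrite memS mem_eq ?group1 // -{1}[x]mulg1 !eqV mulgA !mem_eq ?group1 //.
  have -> : ((x * y)^-1 * (y * m) \in M :\ 1) = false.
    by rewrite mulgA mem_in // xyx invMg invgK mulgKV.
  by rewrite mulKg orbF.
have memxy m : m \in M -> (x * y * m \in S) = (m != 1).
  move=> mM; rewrite memS mem_eq ?group1 // -{2}[x]mulg1 !eqV.
  have e u : u \in M -> (x^-1 * (x * y * m) == u) = false.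
    by move=> uM; rewrite -!mulgA mulKg mem_eq.
  have -> : (y^-1 * (x * y * m) \in A) = false.
    by rewrite !mulgA -[y^-1 * x * y]mulgA -/(x ^ y) xy mem_in ?V.
  by rewrite !e ?group1 // mulKg in_setD1 mM andbT.
have coverM : forall w, exists q m, [/\ q \in [:: 1; x; y; x * y], m \in M & w = q * m] := cover.
have cAM : A \subset M := cA.
have chM : M \char [set: G] := center_char _.
clearbody S M.
pose nS w := #|[set m in M | w * m \in S]|.
have n1 : nS 1 = 1%N.
  rewrite -[RHS](cards1 (1 : G)); apply: eq_card => m; rewrite in_set in_set1 mul1g.
  by apply/andP/eqP=> [[mM]|->]; rewrite ?mem1 ?group1 // => /eqP.
have nx : nS x = 2%N.
  transitivity #|[set 1; a]|; last by rewrite cards2 eq_sym a1.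
  apply: eq_card => m; rewrite in_set; apply/andP/idP=> [[mM]|]; first by rewrite memx.
  move=> h; have mM : m \in M by move: h; rewrite in_set2 => /orP[]/eqP->; rewrite ?group1.
  by rewrite memx.
have ny : nS y = #|A|.
  apply: eq_card => m; rewrite in_set; apply/andP/idP=> [[mM]|h]; first by rewrite memy.
  by rewrite memy AM.
have nxyE : nS (x * y) = #|M|.-1.
  rewrite -[RHS]/(#|M|.-1) (cardsD1 1 M) group1 /=.
  apply: eq_card => m; rewrite in_set in_setD1 andbC.
  by have [mM|] := boolP (m \in M); rewrite ?andbF ?memxy // !andbT.
have lt1A : 2 < #|A|.
  have : 1 < #|A| by rewrite cardG_gt1; apply/trivgPn; exists a.
  by have := odd_core_odd G; case: #|A| => [|[|[|]]].
have leAM : 2 * #|A| <= #|M|.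
  have zA : z \notin A.
    by apply: contraNN z1 => zA; apply/eqP; apply: odd_sqr1 zz.
  have ltAM : A \proper M.
    by rewrite properE cAM; apply/subsetPn; exists z.
  have /dvdnP[k kE] := cardSg cAM.
  move: (proper_card ltAM); rewrite kE leq_mul2r => /[dup] _.
  by case: k kE => [|[|k]] //; rewrite ?mul0n ?mul1n ?ltnn ?orbT.
have nS_mul w m0 : m0 \in M -> nS (w * m0) = nS w.
  move=> m0M; rewrite /nS -(card_lcoset [set m in M | w * m0 * m \in S] m0).
  apply: eq_card => m; rewrite mem_lcoset !in_set groupMl ?groupV //.
  by rewrite -mulgA mulKVg.
have sqV q : q * q = z -> q^-1 = q * z.
  by move=> qq; apply: (mulgI q); rewrite mulgV mulgA qq zz.
have xyV : (x * y)^-1 = x * y * z.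
  by apply: sqV; rewrite mulgA -(mulgA x y) yxE !mulgA -expg2 -zE -!mulgA czy (mulgA y) -expg2 yx -zE zz mulg1.
have yV : y^-1 = y * z by apply: sqV; rewrite -expg2 yx.
have nS_inv w : nS w^-1 = nS w.
  have [q [m [qs mM ->]]] := coverM w.
  rewrite invMg (cM _ q^-1) ?groupV // !nS_mul ?groupV //.
  move: qs; rewrite !inE => /or4P[]/eqP->; rewrite ?invg1 //.
  - by rewrite xV nS_mul.
  - by rewrite yV nS_mul.
  by rewrite xyV nS_mul.
have [g [f [fM SE]]] := invg_affine S.
have {}SE w : (w^-1 \in S) = (f^-1 (g^-1 * w) \in S).
  rewrite -mem_invg SE; apply/imsetP/idP=> [[s sS ->]|wS].
    by rewrite mulKg permK.
  by exists (f^-1 (g^-1 * w)); rewrite // permKV mulKVg.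
have fZ m : (f m \in M) = (m \in M) by apply: char_morph_perm.
have nf w : nS (g * f w) = nS w.
  have i : injective (fun m => (f m)^-1) by move=> u v /invg_inj/perm_inj.
  rewrite -nS_inv /nS -[RHS](card_imset _ i); apply: eq_card => u.
  have fVM : {morph f^-1 : x y / x * y}.
    by move=> ? ?; apply: (@perm_inj _ f); rewrite fM !permKV.
  have E v : v \in M -> ((g * f w)^-1 * v \in S) = (w * f^-1 v^-1 \in S).
    move=> vM; rewrite -[_ * v]invgK SE invMg invgK !mulgA.
    by rewrite -(mulgA g^-1) (cM v^-1 g) ?groupV // mulKg (cM v^-1) ?groupV // fVM permK.
  rewrite in_set; apply/andP/imsetP=> [[uM]|[m]].
    rewrite E // => uS; exists (f^-1 u^-1); last by rewrite permKV invgK.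
    by rewrite in_set uS andbT -fZ permKV groupV.
  rewrite in_set => /andP[mM mS ->]; rewrite groupV fZ mM; split=> //.
  by rewrite E ?groupV ?fZ // invgK permK.
have neqs : (((1%N == 2%N) = false) * ((1%N == #|A|) = false) * ((2%N == #|A|) = false) *
    ((1%N == #|M|.-1) = false) * ((2%N == #|M|.-1) = false) * ((#|A| == #|M|.-1) = false))%type.
  move: lt1A leAM; move: #|A| #|M|; clear => n k h1 h2.
  by do !split; apply/eqP; lia.
have qf q : q \in [:: 1; x; y; x * y] -> exists2 m, m \in M & g * f q = q * m.
  move=> qs; have [q' [m [q's mM e]]] := coverM (g * f q).
  have := nf q; rewrite e nS_mul // => nq; exists m => //; congr (_ * _).
  by move: qs q's nq; rewrite !inE => /or4P[]/eqP-> /or4P[]/eqP-> //;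
    rewrite ?n1 ?nx ?ny ?nxyE => /eqP; first [by rewrite neqs | by rewrite eq_sym neqs].
have g1 : g = 1.
  have [|m mM] := qf 1; first by rewrite inE eqxx.
  rewrite morph_perm1 // mulg1 mul1g => gm; have := SE g.
  have fV1 : f^-1 1 = 1 by rewrite -{1}(morph_perm1 fM) permK.
  rewrite mulVg fV1 gm !mem1 ?groupV ?group1 //.
  by rewrite eqxx invg_eq1 => /eqP.
have {}SE w : ((f w)^-1 \in S) = (w \in S) by rewrite SE g1 invg1 mul1g permK.
have {}qf q : q \in [:: 1; x; y; x * y] -> exists2 m, m \in M & f q = q * m.
  by move/qf=> [m mM e]; exists m; rewrite // -e g1 mul1g.
have zV : z^-1 = z by apply: (mulgI z); rewrite mulgV zz.
(* z m^-1 has odd order because it lies in A, and f(q)^4 = 1 makes its fourth power trivial. *)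
have fq q m : m \in M -> f q = q * m -> q ^+ 4 = 1 -> z * m^-1 \in A -> f q = q * z.
  move=> mM fqE q4 cIA; suff c1 : z * m^-1 = 1.
    by rewrite fqE; congr (_ * _); apply/eqP; rewrite eq_sym eq_mulgV1 c1.
  have f4 : (f q) ^+ 4 = 1.
    by rewrite -(morph_perm1 fM) -q4 !expgS !expg0 !fM (morph_perm1 fM).
  have m4 : m ^+ 4 = 1.
    by move: f4; rewrite fqE expgMn ?q4 ?mul1g //; apply/commute_sym/cM.
  have c4 : (z * m^-1) ^+ 4 = 1.
    rewrite expgMn; last exact: cM.
    by rewrite expgVn m4 invg1 mulg1 -[4]/(2 * 2)%N expgM (_ : z ^+ 2 = 1) ?expg1n.
  apply: (odd_sqr1 invg_affine cIA); apply: (odd_sqr1 invg_affine); first exact: groupM.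
  by rewrite -[RHS]c4 !expgS expg0 mulg1 !mulgA.
have x4 : x ^+ 4 = 1 by rewrite -ox expg_order.
have fx : f x = x * z.
  have [|m mM fxE] := qf x; first by rewrite !inE eqxx orbT.
  apply: (fq x m) => //.
  have : z * m^-1 \in [set 1; a].
    rewrite -memx ?groupM ?groupV // mulgA -xV -(cM m^-1) ?groupV // -invMg -fxE SE.
    by rewrite -[x]mulg1 memx ?set21.
  by rewrite in_set2 => /orP[]/eqP->; rewrite ?group1.
have fy : f y = y * z.
  have [|m mM fyE] := qf y; first by rewrite !inE eqxx !orbT.
  apply: (fq y m) => //; first by rewrite -[4]/(2 * 2)%N expgM yx -expgM.
  rewrite -memy ?groupM ?groupV // mulgA -yV -(cM m^-1) ?groupV // -invMg -fyE SE.
  by rewrite -[y]mulg1 memy ?group1.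
have fz : f z = z.
  rewrite zE expg2 fM fx -xV -invMg -expg2 -zE zV //.
(* f fixes xyz, whose inverse is xy, the only element of xyM missing from S. *)
have xyzS : x * y * z \in S by rewrite memxy.
have := SE (x * y * z); rewrite xyzS !fM fx fy fz.
have -> : (x * z * (y * z) * z)^-1 = x * y * 1.
  have -> : x * z * (y * z) * z = x * y * z by rewrite -!mulgA zz mulg1 czy.
  by rewrite invMg zV xyV (cM z (x * y * z)) // -(mulgA (x * y)) zz.
by rewrite memxy ?group1 // eqxx.
Qed.

End CentralOddCore.

Lemma nonabelian_K2PCI_group (G : finGroupType) :
    (forall S T : {set G}, haar_iso S T -> affine_equiv S T) ->
    (forall S : {set G}, affine_equiv S S^-1) -> ~~ abelian [set: G] ->
  [\/ [set: G] \isog 'D_6, [set: G] \isog 'Q_8 | [set: G] \isog 'D_10].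
Proof.
move=> hK hV nab; have [cA|nA] := boolP ('O_2^'([set: G]) \subset 'Z([set: G])); last first.
  by case: (odd_core_noncentral hK hV nA); [exact: Or31 | exact: Or33].
have [Q sylQ] := Sylow_exists 2 [set: G].
have pQ := pHall_pgroup sylQ.
have AQ := odd_core_mul_Sylow hV sylQ.
have cAQ : Q \subset 'C('O_2^'([set: G])).
  rewrite centsC (subset_trans cA) // (subset_trans (subsetIr _ _)) //.
  by rewrite centS ?subsetT.
have nabQ : ~~ abelian Q.
  apply: contraNN nab => abQ; rewrite -AQ abelianY abQ cAQ /= andbT.
  exact: (odd_core_abelian hK hV).
have [isoQ [x [y [Qxy ox yx xy]]]] := Sylow2_quaternion8 hK pQ nabQ.
have decomp w : exists m i j, m \in 'O_2^'([set: G]) /\ w = m * (x ^+ i * y ^+ j).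
  have: w \in 'O_2^'([set: G]) <*> Q by rewrite AQ inE.
  rewrite cent_joinEr // => /mulsgP[m q mA + ->].
  case/pprodP: Qxy => _ <- _ /mulsgP[_ _ /cycleP[i ->] /cycleP[j ->] ->].
  by exists m, i, j.
have zM : x ^+ 2 \in 'Z([set: G]).
  rewrite inE in_setT; apply/centP=> w _; have [m [i [j [mA ->]]]] := decomp w.
  apply: commuteM; last apply: commuteM.
  - by apply/commute_sym; have /setIP[_ /centP] := subsetP cA m mA; apply; rewrite inE.
  - by apply/commuteX/commute_sym/commuteX.
  by rewrite -yx; apply/commuteX/commute_sym/commuteX.
have A1 : 'O_2^'([set: G]) = 1.
  apply: (quaternion8_trivial_odd_core hV cA ox yx xy) => w.
  have [m [i [j [mA ->]]]] := decomp w.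
  have cM u v : u \in 'Z([set: G]) -> commute u v.
    by case/setIP=> _ /centP; apply; rewrite inE.
  (* Since x^2 = y^2 is central, exponents matter only through their parity, up to a central
     factor. *)
  have mod2 (u : G) k : u ^+ 2 = x ^+ 2 -> u ^+ k = u ^+ odd k * (x ^+ 2) ^+ k./2.
    by move=> <-; rewrite -expgM mul2n -expgD odd_double_half.
  exists (x ^+ odd i * y ^+ odd j), (m * ((x ^+ 2) ^+ i./2 * (x ^+ 2) ^+ j./2)); split.
  - by case: (odd i); case: (odd j); rewrite ?expg1 ?expg0 ?mulg1 ?mul1g !inE eqxx ?orbT.
  - exact: groupM (subsetP cA m mA) (groupM (groupX _ zM) (groupX _ zM)).
  rewrite (mod2 x i) // (mod2 y j) //.
  have com (p q a b : G) : a \in 'Z([set: G]) -> m * ((p * a) * (q * b)) = (p * q) * (m * (a * b)).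
    move=> aZ; rewrite (cM m) ?(subsetP cA) // -!mulgA; congr (_ * _).
    by rewrite (mulgA a) (cM a q) // -mulgA (mulgA a) -(cM m) ?(subsetP cA).
  by rewrite com //; apply: groupX zM.
by apply: Or32; rewrite -AQ A1 joing1G.
Qed.

(** * Closed walks as an isomorphism invariant *)

(* The number of closed walks of length 6 from o in the bipartite graph R. *)
Definition cycles6 (T U : Type) (L : seq T) (M : seq U) (R : T -> U -> bool) (o : T) : nat :=
  let c x y := count (fun u => R x u && R y u) M in
  sumn [seq (c o x * sumn [seq (c x y * c y o)%N | y <- L])%N | x <- L].

Lemma cycles6_map (T U T' : eqType) (U' : Type) (L : seq T) (M : seq U) R (R' : T' -> U' -> bool)
    (f : T -> T') (h : U -> U') o :
    o \in L -> {in L & M, forall x u, R x u = R' (f x) (h u)} ->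
  cycles6 L M R o = cycles6 (map f L) (map h M) R' (f o).
Proof.
move=> oL RE; rewrite /cycles6 -map_comp; congr sumn.
have cE x y : x \in L -> y \in L -> count (fun u => R x u && R y u) M
    = count (fun u => R' (f x) u && R' (f y) u) (map h M).
  by move=> xL yL; rewrite count_map; apply: eq_in_count => u uM /=; rewrite !RE.
apply/eq_in_map => x xL /=; rewrite cE //; congr (_ * _)%N.
rewrite -map_comp; congr sumn; apply/eq_in_map => y yL /=.
by rewrite !cE.
Qed.

Lemma cycles6_perm (T : eqType) (U : eqType) (L L' : seq T) (M M' : seq U) R o :
  perm_eq L L' -> perm_eq M M' -> cycles6 L M R o = cycles6 L' M' R o.
Proof.
move=> pL pM; rewrite /cycles6.
have cE x y : count (fun u => R x u && R y u) M = count (fun u => R x u && R y u) M'.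
  by move/seq.permP: pM => ->.
have -> : [seq (count (fun u => R o u && R x u) M *
             sumn [seq (count (fun u => R x u && R y u) M *
               count (fun u => R y u && R o u) M)%N | y <- L])%N | x <- L]
        = [seq (count (fun u => R o u && R x u) M' *
             sumn [seq (count (fun u => R x u && R y u) M' *
               count (fun u => R y u && R o u) M')%N | y <- L'])%N | x <- L].
  apply: eq_map => x; rewrite cE; congr (_ * _)%N.
  have -> : [seq (count (fun u => R x u && R y u) M * count (fun u => R y u && R o u) M)%N | y <- L]
     = [seq (count (fun u => R x u && R y u) M' * count (fun u => R y u && R o u) M')%N | y <- L].
    by apply: eq_map => y; rewrite !cE.
  by apply: perm_sumn; apply: perm_map.
by apply: perm_sumn; apply: perm_map.
Qed.

Definition haar_cycles6 (G : finGroupType) (S : {set G}) : nat :=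
  cycles6 (enum G) (enum G) (fun x u => u * x^-1 \in S) 1.

(** An isomorphism may move the base vertex 1; right translation, an automorphism of BCay(T), brings
    it back. *)
Lemma haar_iso_cycles6 (G : finGroupType) (S T : {set G}) :
  haar_iso S T -> haar_cycles6 S = haar_cycles6 T.
Proof.
move=> [f1 [f2 E]].
have i (f : {perm G}) : injective (fun x => f x * (f1 1)^-1) by move=> x y /mulIg/perm_inj.
have pE (f : {perm G}) : perm_eq [seq f x * (f1 1)^-1 | x <- enum G] (enum G).
  apply: uniq_perm; rewrite ?(map_inj_uniq (i f)) ?enum_uniq // => g.
  rewrite mem_enum; apply/mapP; exists (f^-1 (g * f1 1)); rewrite ?mem_enum //.
  by rewrite permKV mulgK.
rewrite /haar_cycles6.
rewrite (@cycles6_map _ _ _ _ _ _ _ (fun x u => u * x^-1 \in T) (fun x => f1 x * (f1 1)^-1)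
  (fun x => f2 x * (f1 1)^-1)) ?mem_enum //; last first.
  by move=> x u _ _; rewrite /= E invMg invgK mulgA mulgKV.
by rewrite mulgV; apply: cycles6_perm.
Qed.

(** * Enumeration of subsets up to affine equivalence *)

Section Model.
Variables n s : nat.
Local Open Scope nat_scope.

(* The code k stands for y ^ (n <= k) * x ^ (k mod n), where x ^ n = 1, x ^ y = x^-1 and y ^ 2 = x ^ s. *)
Definition mmul j k :=
  let e := n <= j in let f := n <= k in
  let i := if e then j - n else j in let l := if f then k - n else k in
  let i' := (if f then n - i else i) + l + (if e && f then s else 0) in
  (if e (+) f then n else 0) + i' %% n.

Definition codes := iota 0 (n + n).
Definition minv k := find (fun j => mmul j k == 0) codes.
Definition mdivs := [seq [seq mmul u (minv x) | u <- codes] | x <- codes].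

(** The value at codes x, y of the word that k encodes. A candidate automorphism is fixed by the
    images of the two generators, and these words tabulate it. *)
Definition mword x y k :=
  iter (n <= k) (mmul y) (iter (if n <= k then k - n else k) (mmul x) 0).
Definition mauts :=
  [seq f <- [seq [seq mword x y k | k <- codes] | x <- codes, y <- codes]
  | uniq f && all (fun j => all (fun k =>
      nth 0 f (mmul j k) == mmul (nth 0 f j) (nth 0 f k)) codes) codes].
Definition maffs := [seq [seq mmul g k | k <- f] | g <- codes, f <- mauts].

(** Pulling m back along the table t gives r, so t carries the set of r onto the set of m. *)
Definition mequiv (affs : seq (seq nat)) (m r : bitseq) :=
  has (fun t => [seq nth false m k | k <- t] == r) affs.
(* From representatives of the k-subsets to representatives of the (k + 1)-subsets. *)
Definition mlevel affs (rs : seq bitseq) :=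
  foldr (fun m rs => if has (mequiv affs m) rs then rs else m :: rs) [::]
    [seq set_nth false r j true | r <- rs, j <- [seq j <- codes | ~~ nth false r j]].
(** Cardinalities run from 0 to 2n, hence n + n + 1 levels. *)
Definition mreps affs :=
  traject (mlevel affs) [:: nseq (n + n) false] (n + n).+1.
Definition mcycles6 (divs : seq (seq nat)) (m : bitseq) :=
  cycles6 codes codes (fun x u => nth false m (nth 0 (nth [::] divs x) u)) 0.
Definition minvset (m : bitseq) := [seq nth false m (minv k) | k <- codes].

(* The walk count separates the affine classes and agrees on a set and its inverse. *)
Definition mcheck :=
  let affs := maffs in let divs := mdivs in let reps := undup (flatten (mreps affs)) in
  uniq [seq mcycles6 divs r | r <- reps] &&
      all (fun r => mcycles6 divs (minvset r) == mcycles6 divs r) reps.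

Hypothesis n_gt0 : 0 < n.

Lemma mmul_lt j k : mmul j k < n + n.
Proof.
rewrite /mmul; set i := (_ + _ + _); have := ltn_pmod i n_gt0.
by case: (_ (+) _); lia.
Qed.

Lemma mem_codes k : (k \in codes) = (k < n + n).
Proof. by rewrite mem_iota. Qed.

Lemma nth_codes (T : Type) (z : T) (F : nat -> T) k : k < n + n -> nth z [seq F j | j <- codes] k = F k.
Proof. by move=> lt_k; rewrite (nth_map 0) ?size_iota // nth_iota. Qed.

Local Open Scope group_scope.

Variables (G : finGroupType) (x y : G).
Hypotheses (xn : x ^+ n = 1) (y2 : y ^+ 2 = x ^+ s) (xy : x ^ y = x^-1).
Hypotheses (oG : #|G| = (n + n)%N) (genG : <[x]> <*> <[y]> = [set: G]).

Definition elt k := y ^+ (n <= k) * x ^+ (if n <= k then k - n else k)%N.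

Lemma expg_modn i : x ^+ (i %% n) = x ^+ i.
Proof. by rewrite {2}(divn_eq i n) expgD mulnC expgM xn expg1n mul1g. Qed.

Lemma xyC i : i <= n -> x ^+ i * y = y * x ^+ (n - i).
Proof.
move=> le_i; have -> : x ^+ (n - i) = (x ^+ i)^-1.
  by apply: (mulgI (x ^+ i)); rewrite -expgD subnKC // xn mulgV.
by rewrite conjgC conjXg xy expgVn.
Qed.

Lemma eltM j k : j < n + n -> k < n + n -> elt (mmul j k) = elt j * elt k.
Proof.
move=> lt_j lt_k; rewrite /elt /mmul.
set i := (if n <= j then _ else _); set l := (if n <= k then k - n else k)%N.
have le_i : i <= n by rewrite /i; case: ifP; lia.
set i' := (_ + _ + _)%N.
have modlt : (i' %% n < n)%N by rewrite ltn_pmod.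
have -> : (n <= (if (n <= j) (+) (n <= k) then n else 0) + i' %% n) = (n <= j) (+) (n <= k).
  by case: (_ (+) _); lia.
have -> : ((if (n <= j) (+) (n <= k) then (if (n <= j) (+) (n <= k) then n else 0) + i' %% n - n
  else (if (n <= j) (+) (n <= k) then n else 0) + i' %% n) = i' %% n)%N by case: (_ (+) _); lia.
rewrite expg_modn /i' !expgD; case: (n <= j); case: (n <= k) => /=;
  rewrite ?expg1 ?expg0 ?mul1g ?mulg1 ?mulgA //.
- rewrite -(mulgA y) xyC // mulgA -expg2 y2 -!mulgA -!expgD; congr (_ ^+ _); lia.
- by rewrite xyC.
Qed.

Lemma elt_surj g : exists2 k, k < n + n & g = elt k.
Proof.
have nxy : <[y]> \subset 'N(<[x]>).
  by rewrite cycle_subG inE -cycleJ xy cycleV.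
have : g \in <[x]> <*> <[y]> by rewrite genG inE.
rewrite norm_joinEr // => /mulsgP[_ _ /cycleP[i ->] /cycleP[j ->] ->].
have e (b : bool) l : exists2 k, k < n + n & y ^+ b * x ^+ l = elt k.
  exists ((if b then n else 0) + l %% n)%N.
    by have := ltn_pmod l n_gt0; case: (b); lia.
  have lt_l := ltn_pmod l n_gt0.
  have eb : (n <= (if b then n else 0) + l %% n) = b by case: (b); lia.
  rewrite /elt eb -[x ^+ l]expg_modn; congr (_ * x ^+ _).
  by case: (b); lia.
have -> : y ^+ j = y ^+ odd j * x ^+ (s * j./2).
  by rewrite expgM -y2 -expgM mul2n -expgD odd_double_half.
case: (odd j); last by rewrite mul1g -expgD; have := e false (i + s * j./2)%N; rewrite mul1g.
rewrite mulgA -[x ^+ i]expg_modn expg1 xyC 1?ltnW ?ltn_pmod // -mulgA -expgD.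
exact: (e true).
Qed.

Definition elts := [seq elt k | k <- codes].

Lemma elts_uniq : uniq elts.
Proof.
apply: (@leq_size_uniq _ (enum G)); first exact: enum_uniq.
  by move=> g _; have [k lt_k ->] := elt_surj g; apply: map_f; rewrite mem_codes.
by rewrite size_map size_iota -cardE oG.
Qed.

Definition code g := index g elts.

Lemma code_lt g : code g < n + n.
Proof.
have -> : (n + n = size elts)%N by rewrite size_map size_iota.
by rewrite index_mem; have [k lt_k ->] := elt_surj g; apply: map_f; rewrite mem_codes.
Qed.

Lemma codeK g : elt (code g) = g.
Proof.
rewrite -(nth_codes 1 elt (code_lt g)) nth_index //.
by have [k lt_k ->] := elt_surj g; apply: map_f; rewrite mem_codes.
Qed.

Lemma eltK k : k < n + n -> code (elt k) = k.
Proof.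
by move=> lt_k; rewrite -(nth_codes 1 elt lt_k) /code index_uniq ?elts_uniq ?size_map ?size_iota.
Qed.

Lemma elt0 : elt 0 = 1.
Proof. by rewrite /elt leqNgt n_gt0 mul1g. Qed.

Lemma elt_minv k : k < n + n -> minv k < n + n /\ elt (minv k) = (elt k)^-1.
Proof.
move=> lt_k; have hs : has (fun j => mmul j k == 0%N) codes.
  apply/hasP; exists (code (elt k)^-1); first by rewrite mem_codes code_lt.
  apply/eqP; rewrite -[LHS]eltK ?mmul_lt // eltM ?code_lt // codeK mulVg.
  by rewrite -elt0 eltK ?addn_gt0 ?n_gt0.
have lt_m : minv k < n + n by rewrite /minv -[X in _ < X](size_iota 0) -has_find.
split=> //; apply: (mulIg (elt k)); rewrite mulVg -eltM // -elt0; congr elt.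
have := nth_find 0 hs; rewrite -/(minv k) nth_iota ?add0n //; last by move/eqP.
Qed.

Definition maskset (m : bitseq) := [set g | nth false m (code g)].

Definition table_fun (t : seq nat) g := elt (nth 0 t (code g)).

Lemma mautsP f : f \in mauts -> size f = (n + n)%N /\ exists a : {perm G},
  {morph a : u v / u * v} /\ forall k, k < n + n -> nth 0 f k < n + n /\ a (elt k) = elt (nth 0 f k).
Proof.
rewrite mem_filter => /andP[/andP[uf homf] /allpairsP[[p q] /= [pc qc fE]]].
rewrite !mem_codes in pc qc.
have iter_lt z w i : w < n + n -> iter i (mmul z) w < n + n by case: i => //= i; rewrite mmul_lt.
have lt_f k : k < n + n -> nth 0 f k < n + n.
  by move=> lt_k; rewrite fE nth_codes // /mword !iter_lt // addn_gt0 n_gt0.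
have sf : size f = (n + n)%N by rewrite fE size_map size_iota.
have ai : injective (table_fun f).
  move=> u v /(congr1 code); rewrite !eltK ?lt_f ?code_lt // => /eqP.
  by rewrite nth_uniq ?sf ?code_lt // => /eqP/(congr1 elt); rewrite !codeK.
split=> //; exists (perm ai); split=> [u v|k lt_k]; last by rewrite permE /table_fun eltK ?lt_f.
have codeM : code (u * v) = mmul (code u) (code v).
  rewrite -{1}(codeK u) -{1}(codeK v) -eltM ?code_lt //.
  exact/eltK/mmul_lt.
rewrite !permE /table_fun codeM -eltM ?lt_f ?code_lt //; congr elt; apply/eqP.
have /allP/(_ (code u)) := homf; rewrite mem_codes code_lt => /(_ isT).
by move/allP/(_ (code v)); rewrite mem_codes code_lt => /(_ isT).
Qed.

Lemma mequiv_affine (m r : bitseq) : mequiv maffs m r -> affine_equiv (maskset r) (maskset m).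
Proof.
case/hasP=> t /allpairsP[[g f] /= [gc /mautsP[sf [a [aM aE]]] ->]] /eqP rE.
rewrite mem_codes in gc.
exists (elt g), a; split=> //.
have inE' h : (h \in maskset r) = (elt g * a h \in maskset m).
  rewrite !inE -rE -map_comp (nth_map 0) ?sf ?code_lt //=.
  have [lt_f aE'] := aE _ (code_lt h).
  by rewrite -{2}(codeK h) aE' -eltM // eltK ?mmul_lt.
apply/setP=> w; apply/idP/imsetP=> [wm|[h hr ->]]; last by rewrite -inE'.
by exists (a^-1 ((elt g)^-1 * w)); rewrite ?inE' permKV mulKVg.
Qed.

Lemma affine_equiv_refl (S : {set G}) : affine_equiv S S.
Proof.
exists 1, 1; split=> [u v|]; first by rewrite !perm1.
by rewrite -[LHS]imset_id; apply: eq_imset => u; rewrite perm1 mul1g.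
Qed.

Lemma mem_level_foldr affs (ms : seq bitseq) m : m \in ms ->
  let rs := foldr (fun m rs => if has (mequiv affs m) rs then rs else m :: rs) [::] ms in
  exists2 r, r \in rs & m = r \/ mequiv affs m r.
Proof.
elim: ms => //= m' ms IH; rewrite inE => /orP[/eqP->|/IH[r rin e]].
  case: ifP => [/hasP[r rin e]|_]; first by exists r => //; right.
  by exists m'; [rewrite inE eqxx | left].
by exists r => //; case: ifP => //; rewrite inE rin orbT.
Qed.

Lemma sub_level_foldr affs (ms : seq bitseq) r :
  r \in foldr (fun m rs => if has (mequiv affs m) rs then rs else m :: rs) [::] ms -> r \in ms.
Proof.
elim: ms => //= m ms IH; case: ifP => _; rewrite ?inE; first by move/IH->; rewrite orbT.
by case/orP=> [->//|/IH->]; rewrite orbT.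
Qed.

Let lvl k := iter k (mlevel maffs) [:: nseq (n + n) false].

Lemma size_level k r : r \in lvl k -> size r = (n + n)%N.
Proof.
elim: k r => [|k IH] r; first by rewrite inE => /eqP->; rewrite size_nseq.
move/sub_level_foldr/allpairsPdep=> [r' [j [/IH sr']]].
rewrite mem_filter mem_codes => /andP[_ lt_j] ->.
by rewrite size_set_nth sr'; apply/maxn_idPr.
Qed.

(** Remove a point from S: the rest is equivalent to a listed r, and the same map takes S to r with
    one point added, which the next level covers. Only representatives are extended, so the list of
    all subsets is never formed. *)
Lemma level_affine (S : {set G}) : exists2 r, r \in lvl #|S| & affine_equiv S (maskset r).
Proof.
move: {2}#|S| (erefl #|S|) => k; elim: k S => [|k IH] S oS; rewrite oS.
  exists (nseq (n + n) false); first by rewrite inE.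
  rewrite (cards0_eq oS); suff -> : maskset (nseq (n + n) false) = set0 by apply: affine_equiv_refl.
  by apply/setP=> g; rewrite !inE nth_nseq if_same.
have [u uS] : exists u, u \in S by apply/set0Pn; rewrite -card_gt0 oS.
have oS' : #|S :\ u| = k by apply: succn_inj; rewrite -oS (cardsD1 u S) uS.
have [r rin [g [a [aM rE]]]] := IH _ oS'; rewrite oS' in rin.
have sr := size_level rin.
have r_new : ~~ nth false r (code (g * a u)).
  have -> : nth false r (code (g * a u)) = (g * a u \in maskset r) by rewrite inE.
  by rewrite rE; apply/imsetP=> -[v] /setD1P[vu _] /mulgI/perm_inj e; rewrite e eqxx in vu.
pose m := set_nth false r (code (g * a u)) true.
have S_m : affine_equiv S (maskset m).
  exists g, a; split=> //; apply/setP=> w.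
  rewrite inE nth_set_nth /= -{1}(setD1K uS) imsetU1 in_setU1 -rE inE.
  rewrite -(inj_eq (can_inj codeK)).
  by case: eqP => [->//|].
have /(mem_level_foldr maffs)[r' r'in mr'] : m \in
    [seq set_nth false r j true | r <- lvl k, j <- [seq j <- codes | ~~ nth false r j]].
  by apply/allpairsPdep; exists r, (code (g * a u)); rewrite mem_filter mem_codes code_lt r_new.
exists r' => //; case: mr' => [<- //|/mequiv_affine/affine_equiv_sym].
exact: affine_equiv_trans.
Qed.

Lemma maskset_cycles6 r : haar_cycles6 (maskset r) = mcycles6 mdivs r.
Proof.
have pe : perm_eq elts (enum G).
  apply: uniq_perm; rewrite ?elts_uniq ?enum_uniq // => g.
  by rewrite mem_enum; apply/mapP; exists (code g); rewrite ?mem_codes ?code_lt ?codeK.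
rewrite /haar_cycles6 -(cycles6_perm _ _ pe pe) -elt0; apply/esym/cycles6_map.
  by rewrite mem_codes addn_gt0 n_gt0.
move=> j k; rewrite !mem_codes => lt_j lt_k.
have [lt_m mE] := elt_minv lt_j.
by rewrite inE -mE -eltM // eltK ?mmul_lt // /mdivs !nth_codes.
Qed.

Lemma maskset_inv r : maskset (minvset r) = (maskset r)^-1.
Proof.
apply/setP=> g; rewrite !inE nth_codes ?code_lt //; congr nth.
have [lt_m mE] := elt_minv (code_lt g).
by rewrite -[LHS]eltK // mE codeK.
Qed.

(** Every set is equivalent to a listed one, and the listed ones have distinct walk counts; so equal
    counts imply affine equivalence, both for isomorphic sets and for S and S^-1. *)
Lemma mcheck_K2PCI : mcheck -> K2PCI_group G.
Proof.
case/andP=> uniq_w /allP inv_w _ [S ->]; apply/K2PCI_BCayP.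
set reps := undup _ in uniq_w inv_w.
have rep (T : {set G}) : exists2 r, r \in reps & affine_equiv T (maskset r).
  have [r rin Tr] := level_affine T; exists r => //.
  rewrite mem_undup; apply/flattenP; exists (lvl #|T|) => //.
  by apply/trajectP; exists #|T|; rewrite // ltnS -oG max_card.
have w_eqv (T U : {set G}) : haar_cycles6 T = haar_cycles6 U -> affine_equiv T U.
  have [r rin Tr] := rep T; have [q qin Uq] := rep U.
  rewrite (haar_iso_cycles6 (affine_equiv_haar Tr)) (haar_iso_cycles6 (affine_equiv_haar Uq)).
  rewrite !maskset_cycles6 => e.
  have rq : r = q.
    have [ri qi] : index r reps < size reps /\ index q reps < size reps by rewrite !index_mem.
    have := nth_uniq 0%N (s := [seq mcycles6 mdivs r | r <- reps]).
    move/(_ (index r reps) (index q reps)); rewrite size_map => /(_ ri qi uniq_w).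
    rewrite !(nth_map [::]) // !nth_index // e eqxx => /esym/eqP ei.
    by rewrite -(nth_index [::] rin) ei nth_index.
  by rewrite rq in Tr; apply: affine_equiv_trans Tr (affine_equiv_sym Uq).
split=> [T /haar_iso_cycles6|]; first exact: w_eqv.
apply: w_eqv; have [r rin Sr] := rep S.
rewrite (haar_iso_cycles6 (affine_equiv_haar Sr)).
rewrite (haar_iso_cycles6 (affine_equiv_haar (affine_equivV Sr))).
by rewrite -maskset_inv !maskset_cycles6 (eqP (inv_w r rin)).
Qed.

End Model.

(** s = 0 means y^2 = 1, the dihedral case; n = 4, s = 2 means y^2 = x^2, the quaternion group. *)
Lemma mcheck_D6 : mcheck 3 0. Proof. by vm_compute. Qed.
Lemma mcheck_D10 : mcheck 5 0. Proof. by vm_compute. Qed.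
Lemma mcheck_Q8 : mcheck 4 2. Proof. by vm_compute. Qed.

Lemma dihedral_K2PCI (G : finGroupType) n : 1 < n -> mcheck n 0 ->
  [set: G] \isog 'D_(n.*2) -> K2PCI_group G.
Proof.
move=> n1 chk /(isoGrpP _ (Grp_dihedral n1))[oG].
case/existsP=> -[x y] /=; rewrite !xpair_eqE => /and4P[/eqP genG /eqP xn /eqP y2 /eqP xy].
apply: (@mcheck_K2PCI n 0 (ltnW n1) G x y) => //.
by rewrite -cardsT oG card_dihedral // addnn.
Qed.

Lemma quaternion8_K2PCI (G : finGroupType) : [set: G] \isog 'Q_8 -> K2PCI_group G.
Proof.
move=> /(isoGrpP _ (@Grp_quaternion 3 isT))[oG].
case/existsP=> -[x y] /=; rewrite !xpair_eqE => /and4P[/eqP genG /eqP xn /eqP y2 /eqP xy].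
apply: (@mcheck_K2PCI 4 2 isT G x y xn y2 xy _ genG mcheck_Q8).
by rewrite -cardsT oG (@card_quaternion 3).
Qed.

(** * Abelian groups *)

Section Extension.

Variable gT : finGroupType.
Hypothesis abG : abelian [set: gT].
Hypothesis Sylow_homogeneous : forall (p : nat) (P : {group gT}),
  prime p -> p.-Sylow([set: gT]) P -> p.-abelem P \/ cyclic P.
Implicit Types (L M K : {group gT}) (x y : gT).

Lemma abelian_mulgC x y : x * y = y * x.
Proof. exact: (centsP abG) (in_setT x) y (in_setT y). Qed.

Lemma abelian_normal K : K <| [set: gT].
Proof. by rewrite -sub_abelian_normal ?subsetT. Qed.

Lemma p_root_homogeneous p L M x w : prime p -> #|L| = #|M| ->
    p.-elt x -> x \in L -> w \in M -> #[w] = #[x ^+ p] ->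
  exists2 y, y \in M & y ^+ p = w.
Proof.
move=> pr_p eLM px xL wM ow.
have [P sylP] := Sylow_exists p [set: gT].
have memP z : p.-elt z -> z \in P by move=> pz; rewrite (mem_normal_Hall sylP) ?inE ?abelian_normal.
have [abP|cycP] := Sylow_homogeneous pr_p sylP.
  exists 1 => //; case/(abelemP pr_p): abP => _ /(_ x (memP x px)) xp1.
  by move: ow; rewrite xp1 order1 expg1n => /eqP; rewrite order_eq1 => /eqP->.
have sylL K := setI_normal_Hall (abelian_normal P) sylP (subsetT K).
have eLMp : P :&: L = P :&: M.
  apply/eqP; rewrite (eq_subG_cyclic cycP) ?subsetIl //.
  by rewrite (card_Hall (sylL L)) (card_Hall (sylL M)) eLM.
have wP : w \in P by apply: memP; rewrite /p_elt ow; apply: p_eltX.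
have xP : x \in P := memP x px.
have : <[w]> = <[x ^+ p]>.
  by apply/eqP; rewrite (eq_subG_cyclic cycP) ?cycle_subG ?groupX // -!orderE ow.
move=> /setP/(_ w); rewrite cycle_id => /esym/cycleP[k wE].
exists (x ^+ k); last by rewrite wE -!expgM mulnC.
have : x \in P :&: L by rewrite inE xP.
by rewrite eLMp => /setIP[_ xM]; rewrite groupX.
Qed.

Lemma card_p_torsion p L M : prime p -> #|L| = #|M| ->
  #|[set z in L | z ^+ p == 1]| = #|[set z in M | z ^+ p == 1]|.
Proof.
move=> pr_p eLM; have [P sylP] := Sylow_exists p [set: gT].
have sylL K := setI_normal_Hall (abelian_normal P) sylP (subsetT K).
have tors K : [set z in K | z ^+ p == 1] = [set z in P :&: K | z ^+ p == 1].
  apply/setP=> z; rewrite !inE andbC [in RHS]andbC; apply: andb_id2l => /eqP zp.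
  suff -> : z \in P by [].
  rewrite (mem_normal_Hall sylP) ?inE ?abelian_normal // /p_elt.
  by apply: (@pnat_dvd _ p); rewrite ?pnat_id // order_dvdn zp.
rewrite (tors L) (tors M); have eLMp : #|P :&: L| = #|P :&: M|.
  by rewrite (card_Hall (sylL L)) (card_Hall (sylL M)) eLM.
have [abP|cycP] := Sylow_homogeneous pr_p sylP.
  have all K : [set z in P :&: K | z ^+ p == 1] = P :&: K.
    apply/setP=> z; rewrite inE; apply/andb_idr => /setIP[zP _].
    by apply/eqP; case/(abelemP pr_p): abP => _; apply.
  by rewrite !all.
by congr #|_|; move/eqP: eLMp; rewrite -(eq_subG_cyclic cycP) ?subsetIl // => /eqP->.
Qed.

(** Adjoin an element x of least order outside M0 in a Sylow subgroup of L; minimality puts x^p in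
    M0. With y a p-th root of f(x^p) in M outside f(M0), both M0 and <x>, and f(M0) and <y>, meet
    exactly in p-th powers, so f and x -> y glue to an injective map. *)
Lemma extension_step L M M0 (f : {morphism M0 >-> gT}) :
    #|L| = #|M| -> M0 \proper L -> 'injm f -> f @* M0 \subset M ->
  exists (M1 : {group gT}) (h : {morphism M1 >-> gT}),
    [/\ M0 \proper M1, M1 \subset L, 'injm h, h @* M1 \subset M & {in M0, h =1 f}].
Proof.
move=> eLM /properP[sM0L [u uL uM0]] injf fM.
have /existsP[P /andP[/SylowP[p pr_p sylP] PM0]] :
    [exists P : {group gT}, Sylow L P && ~~ (P \subset M0)].
  have : ~~ (L \subset M0) by apply/subsetPn; exists u.
  apply: contraR; rewrite negb_exists => /forallP noP.
  rewrite -{1}(Sylow_gen L) gen_subG; apply/bigcupsP=> P sP.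
  by have := noP P; rewrite sP negbK.
have [x0 x0P x0M] := subsetPn PM0.
pose D := [pred z | z \in P & z \notin M0].
have Dx0 : D x0 by rewrite inE x0P.
case: (arg_minnP (fun z => #[z]) Dx0) => x /andP[xP xM0] minx {x0 x0P x0M Dx0}.
have xL : x \in L := subsetP (pHall_sub sylP) x xP.
have px : p.-elt x := mem_p_elt (pHall_pgroup sylP) xP.
have x1 : x != 1 by apply: contraNneq xM0 => ->.
have pdvd (z : gT) : p.-elt z -> z != 1 -> p %| #[z].
  by move=> pz; rewrite -cycle_eq1 => z1; have [] := pgroup_pdiv (pz : p.-group <[z]>) z1.
have ordp (z : gT) : p.-elt z -> z != 1 -> #[z] = (p * #[z ^+ p])%N.
  by move=> pz z1; rewrite orderXdiv ?pdvd // mulnC divnK ?pdvd.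
have xpM0 : x ^+ p \in M0.
  apply: contraT => xpM0; have := minx (x ^+ p); rewrite inE groupX // => /(_ xpM0).
  by rewrite (ordp x) // leqNgt -{1}[#[x ^+ p]]mul1n ltn_pmul2r ?order_gt0 // prime_gt1.
have ofw : #[f (x ^+ p)] = #[x ^+ p] by apply: order_injm.
have [y0 y0M y0p] := p_root_homogeneous pr_p eLM px xL (subsetP fM _ (mem_morphim _ xpM0 xpM0)) ofw.
(* f (x ^ p) has as many p-th roots in M as x ^ p has in L, and x is a root outside M0. *)
have [y [yM yp yf]] : exists y, [/\ y \in M, y ^+ p = f (x ^+ p) & y \notin f @* M0].
  pose Y := [set z in M | z ^+ p == f (x ^+ p)].
  pose X := [set z in L | z ^+ p == x ^+ p].
  have translate K (z0 w : gT) : z0 \in K -> z0 ^+ p = w ->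
      [set z in K | z ^+ p == w] = z0 *: [set z in K | z ^+ p == 1].
    move=> z0K <-; apply/setP=> z; rewrite mem_lcoset !inE groupMl ?groupV //.
    by rewrite expgMn ?expgVn -?eq_mulVg1 1?eq_sym //; apply: abelian_mulgC.
  have cXY : #|Y| = #|X|.
    by rewrite /X /Y (translate M y0) // (translate L x) // !card_lcoset (card_p_torsion pr_p eLM).
  suff /subsetPn[y] : ~~ (Y \subset f @* M0).
    by rewrite inE => /andP[yM /eqP yp] yf; exists y.
  apply/negP=> sYf; have : #|Y| < #|X|; last by rewrite cXY ltnn.
  apply: (@leq_ltn_trans #|X :&: M0|); last first.
    apply: proper_card; rewrite properE subsetIl; apply/subsetPn; exists x.
      by rewrite inE xL eqxx.
    by rewrite inE (negPf xM0) andbF.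
  rewrite -(card_injm injf (subsetIr X M0)); apply: subset_leq_card.
  apply/subsetP=> z zY; have /morphimP[v vM0 _ zE] := subsetP sYf z zY.
  rewrite zE mem_morphim // inE vM0 inE (subsetP sM0L) //= andbT.
  move: zY; rewrite inE zE => /andP[_]; rewrite -morphX // => /eqP e.
  by apply/eqP; apply: (injmP injf) e => //; apply: groupX.
have y1 : y != 1 by apply: contraNneq yf => ->; apply: group1.
have py : p.-elt y.
  have [n en] := p_natP px.
  have : p.-nat #[x] := px; apply: pnat_dvd; rewrite order_dvdn (ordp x) // expgM yp -ofw expg_order //.
have oxy : #[y] = #[x] by rewrite (ordp y) // (ordp x) // yp ofw.
have dvd_yx : #[y] %| #[x] by rewrite oxy.
(* If p does not divide j then z^j generates <z>, so it cannot lie in K. *)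
have capE (z : gT) K : p.-elt z -> z \notin K -> z ^+ p \in K -> K :&: <[z]> = <[z ^+ p]>.
  move=> pz zK zpK; apply/eqP; rewrite eqEsubset subsetI !cycle_subG zpK mem_cycle !andbT.
  apply/subsetP=> _ /setIP[/[swap] /cycleP[j ->] zj].
  have [/dvdnP[i ->]|pj] := boolP (p %| j).
    by rewrite mulnC expgM mem_cycle.
  case/negP: zK; suff : z \in <[z ^+ j]>.
    by apply: subsetP; rewrite cycle_subG.
  have : generator <[z]> (z ^+ j).
    rewrite generator_coprime; have [n ->] := p_natP pz.
    by rewrite coprimeXl // prime_coprime.
  by move/eqP <-; apply: cycle_id.
have defM1 : M0 \* <[x]> = M0 <*> <[x]>.
  by rewrite cprodEY //; apply/centsP=> v _ w _; apply: abelian_mulgC.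
have cfx : eltm dvd_yx @* <[x]> \subset 'C(f @* M0).
  by apply/centsP=> v _ w _; apply: abelian_mulgC.
have eqfx : {in M0 :&: <[x]>, f =1 eltm dvd_yx}.
  rewrite capE // => _ /cycleP[i ->].
  by rewrite morphX // -yp -!expgM eltmE.
pose h := cprodm_morphism defM1 cfx eqfx.
exists (M0 <*> <[x]>)%G, h; split.
- rewrite properE joing_subl; apply/subsetPn; exists x => //.
  by rewrite mem_gen // inE cycle_id orbT.
- by rewrite join_subG sM0L cycle_subG.
- rewrite injm_cprodm injf injm_eltm oxy dvdnn /=.
  rewrite im_eltm (capE y [group of f @* M0]) // ?yp ?mem_morphim //.
  by rewrite -(morphimIdom f) capE // morphim_cycle.
- rewrite /= im_cprodm im_eltm mul_subG // cycle_subG //.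
by move=> v vM0; rewrite /= cprodmEl.
Qed.

Lemma extension L M M0 (f : {morphism M0 >-> gT}) :
    #|L| = #|M| -> M0 \subset L -> 'injm f -> f @* M0 \subset M ->
  exists h : {morphism L >-> gT}, [/\ 'injm h, h @* L = M & {in M0, h =1 f}].
Proof.
move=> eLM; move: {2}(#|L| - #|M0|)%N (leqnn (#|L| - #|M0|)) => m.
elim: m M0 f => [|m IH] M0 f le_m sM0L injf fM.
  all: have [prM0|eM0L] := boolP (M0 \proper L).
- by have := proper_card prM0; rewrite ltnNge -subn_eq0 -leqn0 le_m.
- have {eM0L}eM0L : M0 = L.
    by apply/val_inj/eqP; rewrite eqEsubset sM0L; move: eM0L; rewrite properE sM0L negbK.
  subst M0; exists f; split=> //; apply/eqP.
  by rewrite eqEcard fM card_injm //= eLM.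
- have [M1 [h [prM1 sM1L injh hM hf]]] := extension_step eLM prM0 injf fM.
  have [||||h' [inj' h'M h'h]] := IH M1 h => //.
    by have := proper_card prM1; have := subset_leq_card sM1L; lia.
  exists h'; split=> // v vM0; rewrite h'h ?hf //.
  by apply: subsetP (proper_sub prM1) v vM0.
have {eM0L}eM0L : M0 = L.
  by apply/val_inj/eqP; rewrite eqEsubset sM0L; move: eM0L; rewrite properE sM0L negbK.
subst M0; exists f; split=> //; apply/eqP.
by rewrite eqEcard fM card_injm //= eLM.
Qed.

Lemma extension_perm M0 (f : {morphism M0 >-> gT}) : 'injm f ->
  exists a : {perm gT}, {morph a : x y / x * y} /\ {in M0, a =1 f}.
Proof.
move=> injf.
have [|||h [injh _ hf]] := @extension [set: gT]%G [set: gT]%G M0 f (erefl _) => //;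
  try exact: subsetT.
have hi : injective h by move=> x y; apply: (injmP injh); rewrite inE.
exists (perm hi); split=> [x y|x xM]; rewrite !permE; first by rewrite morphM ?inE.
exact: hf.
Qed.

End Extension.

Lemma abelian_affine_equivV (gT : finGroupType) (S : {set gT}) :
  abelian [set: gT] -> affine_equiv S S^-1.
Proof.
move=> abG.
have i : injective (fun x : gT => x^-1) by apply: invg_inj.
exists 1, (perm i); split=> [x y|].
  by rewrite !permE invMg (abelian_mulgC abG).
rewrite -[S^-1]/(S^-1); apply/setP=> x; rewrite inE; apply/idP/imsetP=> [xS|[s sS ->]].
  by exists x^-1; rewrite // permE invgK mul1g.
by rewrite permE mul1g invgK.
Qed.

(** * Passing between an abelian group and its subgroups *)

Section Abelian.

Variable gT : finGroupType.
Hypothesis abG : abelian [set: gT].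
Implicit Types (S T : {set gT}) (L : {group gT}).

Hypothesis Sylow_homogeneous : forall (p : nat) (P : {group gT}),
  prime p -> p.-Sylow([set: gT]) P -> p.-abelem P \/ cyclic P.

Lemma subg_affine_equiv L S T : S \subset L -> T \subset L ->
  @affine_equiv (subg_of L) (sgval @^-1: S) (sgval @^-1: T) -> affine_equiv S T.
Proof.
move=> SL TL [g [b [bM TE]]].
pose f x := sgval (b (subg L x)).
have fM : {in L &, {morph f : x y / x * y}}.
  by move=> x y xL yL; rewrite /f morphM // bM.
pose fm : {morphism L >-> gT} := Morphism fM.
have injf : 'injm fm.
  apply/injmP=> x y xL yL /= /(can_inj sgvalK)/perm_inj/(congr1 sgval).
  by rewrite !subgK.
have [a [aM af]] := extension_perm abG Sylow_homogeneous injf.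
exists (sgval g), a; split=> //; apply/setP=> x; apply/idP/imsetP=> [xT|[s sS ->]].
  have : subg L x \in sgval @^-1: T by rewrite inE subgK // (subsetP TL).
  rewrite TE => /imsetP[u]; rewrite inE => uS ux; exists (sgval u) => //.
  have := congr1 sgval ux; rewrite subgK ?(subsetP TL) // => ->.
  by rewrite af ?subgP //= /f sgvalK.
have : g * b (subg L s) \in sgval @^-1: T.
  by rewrite TE; apply: imset_f; rewrite inE subgK // (subsetP SL).
by rewrite inE /= af ?(subsetP SL).
Qed.

Lemma haar_iso_empty S T : haar_iso S T -> S = set0 -> T = set0.
Proof.
move=> [f1 [f2 E]] S0; apply/setP=> t; rewrite inE; apply/negP=> tT.
have := E (f1^-1 1) (f2^-1 t); by rewrite !permKV invg1 mulg1 tT S0 inE.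
Qed.

(** After translation S and T contain 1, and the isomorphism matches <S> with <T>, so their orders
    agree. An automorphism of G then carries <T> onto <S>, and K2PCI over <S> applies to the
    translated S. *)
Lemma abelian_K2PCI_group_suff :
  (forall S, @K2PCI (subg_of <<S>>) (@BCay (subg_of <<S>>) (sgval @^-1: S))) ->
  K2PCI_group gT.
Proof.
move=> subK _ [S ->]; apply/K2PCI_BCayP; split=> [T ST|]; last exact: abelian_affine_equivV.
have [S0|/set0Pn[s sS]] := eqVneq S set0.
  by rewrite (haar_iso_empty ST S0) S0; exists 1, 1; split=> [x y|]; rewrite ?perm1 // imset0.
have [T0|/set0Pn[t tT]] := eqVneq T set0.
  by rewrite (haar_iso_empty (haar_iso_sym ST) T0) inE in sS.
pose S1 := s^-1 *: S; pose T1 := t^-1 *: T.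
have S11 : 1 \in S1 by rewrite mem_lcoset invgK mulg1.
have T11 : 1 \in T1 by rewrite mem_lcoset invgK mulg1.
have SS1 : affine_equiv S S1 := affine_equiv_mull _ _.
have TT1 : affine_equiv T T1 := affine_equiv_mull _ _.
apply: (affine_equiv_trans SS1); apply: affine_equiv_trans (affine_equiv_sym TT1).
have {ST}ST1 : haar_iso S1 T1.
  apply: haar_iso_trans (affine_equiv_haar TT1).
  exact: haar_iso_trans (affine_equiv_haar (affine_equiv_sym SS1)) ST.
have eTS : #|<<T1>>| = #|<<S1>>|.
  have [f1 [_ [_ <- _]]] := haar_iso_gen S11 T11 ST1.
  by rewrite (card_imset _ (@perm_inj _ f1)).
(* Extending the map of the trivial subgroup yields some isomorphism from <T1> onto <S1>. *)
have [||||h [injh hT _]] := @extension _ abG Sylow_homogeneous <<T1>>%G <<S1>>%G 1%G [morphism of idm [1 gT]] => //.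
- exact: sub1G.
- exact: injm_idm.
- by rewrite morphim1 sub1G.
have [a [aM ah]] := extension_perm abG Sylow_homogeneous injh.
pose T2 := a @: T1.
have TT2 : affine_equiv T1 T2.
  by exists 1, a; split=> //; apply: eq_imset => x; rewrite mul1g.
have T21 : 1 \in T2 by apply/imsetP; exists 1; rewrite ?morph_perm1.
have gT2 : <<T2>> = <<S1>>.
  rewrite -hT; have -> : T2 = h @* T1.
    rewrite morphimEsub ?subset_gen //; apply: eq_in_imset => x xT; rewrite ah //.
    exact: mem_gen.
  by rewrite morphim_gen ?subset_gen.
apply: affine_equiv_trans (affine_equiv_sym TT2).
apply: (@subg_affine_equiv <<S1>>%G); rewrite ?subset_gen //.
  by rewrite /= -gT2 subset_gen.
have /K2PCI_BCayP[+ _] := subK S1; apply.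
apply: (@haar_iso_subg _ _ _ <<S1>>%G) => //.
exact: haar_iso_trans ST1 (affine_equiv_haar TT2).
Qed.

(** The automorphism a of G obtained from the lifted isomorphism may move L. It maps M = <s^-1 S>
    into L, because quotients of elements of T lie in L; its restriction to M is extended afresh to
    L, and the translation is corrected by h(s). *)
Lemma abelian_K2PCI_group_sub :
  (forall S T, haar_iso S T -> affine_equiv S T) ->
  forall L S, S \subset L -> @K2PCI (subg_of L) (@BCay (subg_of L) (sgval @^-1: S)).
Proof.
move=> hK L S SL; apply/K2PCI_BCayP; split; last first.
  apply: abelian_affine_equivV; apply/centsP=> u _ v _; apply: (can_inj sgvalK).
  by rewrite !sgvalM ?inE // (abelian_mulgC abG).
move=> T' [f1 [f2 E]]; pose T := [set sgval u | u in T'].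
have memT u : (sgval u \in T) = (u \in T') by rewrite (mem_imset _ _ (can_inj sgvalK)).
have TL : T \subset L by apply/subsetP=> _ /imsetP[u _ ->]; apply: subgP.
have /hK[g [a [aM TE]]] : haar_iso S T.
  pose F (f : {perm subg_of L}) x := sgval (f (subg L x)).
  have FL f : {in L, forall z, F f z \in L} by move=> z _; apply: subgP.
  have FI f : {in L &, injective (F f)}.
    move=> z z' zL z'L /(can_inj sgvalK)/perm_inj/(congr1 sgval).
    by rewrite !subgK.
  apply: (@haar_iso_lift _ L S T (F f1) (F f2)) => // u v uL vL.
  have := E (subg L u) (subg L v); rewrite inE /= -memT.
  have sgM (w w' : subg_of L) : sgval (w * w'^-1) = sgval w * (sgval w')^-1 by [].
  by rewrite !sgM !subgK.
have [S0|/set0Pn[s sS]] := eqVneq S set0.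
  have -> : T' = sgval @^-1: S.
    by apply/setP=> u; rewrite -memT TE S0 imset0 !inE.
  by exists 1, 1; split=> [u v|]; rewrite ?perm1 // -[LHS]imset_id; apply: eq_imset => u; rewrite perm1 mul1g.
pose M := [group of <<s^-1 *: S>>].
have sL := subsetP SL s sS.
have tT v : v \in S -> g * a v \in L.
  by move=> vS; apply: (subsetP TL); rewrite TE; apply/imsetP; exists v.
have ML : M \subset L.
  rewrite gen_subG; apply/subsetP=> _ /lcosetP[v vS ->].
  by rewrite groupM ?groupV // (subsetP SL).
pose am : {morphism M >-> gT} := Morphism (in2W aM).
have injam : 'injm am by apply/injmP=> u v _ _ /perm_inj.
have amL : am @* M \subset L.
  rewrite morphim_gen ?subset_gen // gen_subG morphimEsub ?subset_gen //.
  apply/subsetP=> _ /imsetP[_ /lcosetP[v vS ->] ->] /=.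
  rewrite aM morph_permV // -(mulKg g (a v)) mulgA -invMg.
  by rewrite groupM ?groupV // tT.
have [h [injh hL ha]] := extension abG Sylow_homogeneous (erefl #|L|) ML injam amL.
have hLm v : v \in L -> h v \in L.
  have hsL : h @* L \subset L by rewrite hL.
  by move=> vL; apply: (subsetP hsL); apply: mem_morphim.
have hLmem (u : subg_of L) : h (sgval u) \in L by apply: hLm; apply: subgP.
have b_inj : injective (fun u : subg_of L => subg L (h (sgval u))).
  move=> u v /(congr1 sgval); rewrite !subgK // => /(injmP injh) e.
  by apply: (can_inj sgvalK); apply: e; apply: subgP.
have gaE (u : subg_of L) : sgval u \in S -> g * a (sgval u) = g * a s * (h s)^-1 * h (sgval u).
  move=> uS; have -> : h (sgval u) = h s * a (s^-1 * sgval u).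
    have <- : h (s^-1 * sgval u) = a (s^-1 * sgval u).
      by rewrite ha // mem_gen // mem_lcoset mulKg.
    by rewrite -morphM ?mulKVg ?groupM ?groupV ?subgP.
  by rewrite aM morph_permV // !mulgA mulgKV mulgK.
have gL : g * a s * (h s)^-1 \in L.
  by rewrite groupM ?tT // groupV hLm.
exists (subg L (g * a s * (h s)^-1)), (perm b_inj); split=> [u v|].
  rewrite !permE; apply: (can_inj sgvalK).
  by rewrite subgK ?hLmem // !sgvalM ?inE // !subgK // morphM ?subgP.
apply/setP=> u; rewrite -memT TE; apply/imsetP/imsetP=> [[v vS uE]|[v]].
  have vL : v \in L := subsetP SL v vS.
  have vE : sgval (subg L v) = v by rewrite subgK.
  exists (subg L v); first by rewrite inE vE.
  apply: (can_inj sgvalK); rewrite uE sgvalM ?inE // permE !subgK ?hLm //.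
  by have := gaE (subg L v); rewrite vE => ->.
rewrite inE => vS ->; exists (sgval v) => //.
by rewrite sgvalM ?inE // permE !subgK // gaE.
Qed.

End Abelian.

(** * Excluded cyclic subgroups *)

Section Exclusions.

Variable gT : finGroupType.
Hypothesis abG : abelian [set: gT].
Hypothesis haar_affine : forall S T : {set gT}, haar_iso S T -> affine_equiv S T.
Implicit Types (A : {group gT}) (x y : gT).
Let mulC : commutative (@mulg gT) := abelian_mulgC abG.

(* Apply f in each coset A x, relative to a fixed representative. *)
Lemma haar_iso_fiberwise A (A0 D : {set gT}) (f : gT -> gT) :
    {in A &, {morph f : x y / x * y}} -> {in A &, injective f} ->
    {in A, forall x, f x \in A} -> A0 \subset A ->
    (forall a d, a \in A -> (a * d \in D) = (d \in D)) ->
  haar_iso (A0 :|: D) (f @: A0 :|: D).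
Proof.
move=> fM fI fA A0A DA; have i := coset_map_inj fA fI.
exists (perm i), (perm i) => x y; rewrite !permE !inE.
have f1 : f 1 = 1 by apply: (mulgI (f 1)); rewrite -fM ?mulg1.
have fV z : z \in A -> f z^-1 = (f z)^-1.
  by move=> zA; apply: (mulgI (f z)); rewrite -fM ?groupV // !mulgV.
have cmE z : exists2 a, a \in A & coset_map A f z = a * z.
  have zA := mem_coset_repr A z.
  exists (f (z * (repr (A :* z))^-1) * (z * (repr (A :* z))^-1)^-1).
    by rewrite groupM ?groupV ?fA.
  by rewrite /coset_map invMg invgK -!mulgA mulVg mulg1.
congr (_ || _); last first.
  have [a aA ->] := cmE x; have [b bA ->] := cmE y.
  have -> : b * y * (a * x)^-1 = (b * a^-1) * (y * x^-1).
    by rewrite invMg (mulC x^-1) -!mulgA; congr (_ * _); rewrite !mulgA (mulC y).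
  by rewrite (DA (b * a^-1)) // groupM ?groupV.
have [e|ne] := eqVneq (repr (A :* x)) (repr (A :* y)).
  have xA := mem_coset_repr A x; have yA := mem_coset_repr A y.
  rewrite e in xA; rewrite (coset_map_div _ _ e) -fV // -fM ?groupV //.
  have -> : y * (repr (A :* y))^-1 * (x * (repr (A :* y))^-1)^-1 = y * x^-1.
    by rewrite invMg invgK mulgA mulgKV.
  have yxA : y * x^-1 \in A by rewrite eq_coset_repr e.
  apply/idP/imsetP=> [yx|[z zA0 /fI -> //]]; first by exists (y * x^-1).
  exact: (subsetP A0A).
have fA0 : f @: A0 \subset A by apply/subsetP=> _ /imsetP[z zA0 ->]; rewrite fA ?(subsetP A0A).
rewrite (contraNF (subsetP A0A _)) ?(contraNF (subsetP fA0 _)) //.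
  by rewrite eq_coset_repr !coset_map_repr.
by rewrite eq_coset_repr.
Qed.

(** The full coset xA marks its position: T0 is too small to contain its image, so the affine map
    preserves both A and xA. Its linear part is then x -> x^(1+qi), and it carries A0 into T0. *)
Lemma affine_equiv_coset q x (A0 T0 : {set gT}) :
    x \notin <[x ^+ q]> -> 1 \in A0 -> A0 \subset <[x ^+ q]> -> T0 \subset <[x ^+ q]> ->
    #|T0| < #|<[x ^+ q]>| ->
    affine_equiv (A0 :|: x *: <[x ^+ q]>) (T0 :|: x *: <[x ^+ q]>) ->
  exists g (f : {perm gT}) i, [/\ {morph f : u v / u * v}, f x = x ^+ (1 + q * i),
    g \in T0 & {in A0, forall z, g * f z \in T0}].
Proof.
set A := <[x ^+ q]>%G => xA A01 A0A T0A ltT0 [g [f [fM TE]]].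
have CA : A \subset <[x]> by rewrite cycle_subG mem_cycle.
have TP u : u \in A0 :|: x *: A -> g * f u \in T0 :|: x *: A.
  by move=> uS; rewrite TE; apply/imsetP; exists u.
have TC : T0 :|: x *: A \subset <[x]>.
  rewrite subUset (subset_trans T0A CA); apply/subsetP=> _ /lcosetP[v vA ->].
  by rewrite groupM ?cycle_id ?(subsetP CA).
have gT0A : g \in T0 :|: x *: A by have := TP 1; rewrite !inE A01 morph_perm1 // mulg1; apply.
have gC : g \in <[x]> := subsetP TC g gT0A.
have xS : x \in A0 :|: x *: A by rewrite inE mem_lcoset mulVg group1 orbT.
have fxC : f x \in <[x]> by rewrite -(groupMl _ gC) (subsetP TC) ?TP.
have fX u n : f (u ^+ n) = f u ^+ n.
  by elim: n => [|n IH]; rewrite ?expg0 ?morph_perm1 // !expgS fM IH.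
have fA u : u \in A -> f u \in A.
  case/cycleP: fxC => k fxE /cycleP[i ->].
  by rewrite !fX fxE -!expgM mulnC -mulnA expgM mem_cycle.
have fAE : f @: A = A.
  apply/eqP; rewrite eqEcard (card_imset _ (@perm_inj _ f)) leqnn andbT.
  by apply/subsetP=> _ /imsetP[u uA ->]; apply: fA.
have T0xA u : u \in T0 :|: x *: A -> u \in A -> u \in T0.
  rewrite inE => /orP[//|]; rewrite mem_lcoset => xu uA.
  by case/negP: xA; rewrite -groupV -(groupMr _ uA).
(* If g f(x) were in T0, the image of xA would be all of A and lie in T0. *)
have gfx : x^-1 * (g * f x) \in A.
  have := TP x xS; rewrite inE => /orP[gfT0|]; last by rewrite mem_lcoset.
  have: A \subset T0; last by move/subset_leq_card; rewrite leqNgt ltT0.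
  apply/subsetP=> u uA; have gfA := subsetP T0A _ gfT0.
  have : (g * f x)^-1 * u \in A by rewrite groupM ?groupV.
  rewrite -{1}fAE => /imsetP[v vA uE].
  apply: T0xA => //; have -> : u = g * f (x * v) by rewrite fM mulgA -uE mulKVg.
  by apply: TP; rewrite inE mem_lcoset mulKg vA orbT.
have gA : g \in A.
  move: gT0A; rewrite inE mem_lcoset => /orP[/(subsetP T0A)//|xg].
  have : f x \in A by rewrite -(groupMl _ xg) -mulgA.
  rewrite -{1}fAE => /imsetP[v vA /perm_inj xv].
  by case/negP: xA; rewrite [X in X \in _]xv.
have : x^-1 * f x \in A by rewrite -(groupMl _ gA) mulgA (mulC g) -mulgA.
case/cycleP=> i fxE.
exists g, f, i; split=> //.
- by rewrite expgD expgM -fxE mulKVg.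
- exact: T0xA.
move=> z zA0; apply: T0xA; first by apply: TP; rewrite inE zA0.
exact: groupM gA (fA z (subsetP A0A z zA0)).
Qed.

Lemma coset_absorb A x a d : a \in A -> (a * d \in x *: A) = (d \in x *: A).
Proof. by move=> aA; rewrite !mem_lcoset (mulC a) mulgA groupMr. Qed.

(** Square the elements of A only: {1, x^p} becomes {1, x^(2p)}. An affine equivalence fixes x^p, so
    it acts on A as a translation, and these sets are translates only if p divides 1, 2 or 3. For p
    = 3 they are translates, which is why order 9 survives. *)
Lemma no_order_p2 (p : nat) x : prime p -> 4 < p -> #[x] <> (p ^ 2)%N.
Proof.
move=> pr_p p4 ox; pose A := <[x ^+ p]>%G.
have p0 := prime_gt0 pr_p.
have oxp : #[x ^+ p] = p by rewrite orderXdiv ox ?dvdn_exp // expnS expn1 mulnK.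
have eqx i j : (x ^+ i == x ^+ j) = (i == j %[mod p ^ 2]) by rewrite eq_expg_mod_order ox.
have xA : x \notin A.
  apply/negP=> xA; have := order_dvdG xA; rewrite -orderE oxp ox.
  by move/(dvdn_leq p0); rewrite expnS expn1 leqNgt -{1}[p]muln1 ltn_pmul2l // prime_gt1.
have xpA : x ^+ p \in A := cycle_id _.
pose A0 := [set 1; x ^+ p].
have A0A : A0 \subset A by apply/subsetP=> u; rewrite !inE => /orP[]/eqP->; rewrite ?group1.
have sqI : {in A &, injective (fun z : gT => z ^+ 2)}.
  move=> u v uA vA /= /eqP; rewrite eq_mulgV1 -expgVn -expgMn; last exact: mulC.
  rewrite -order_dvdn => d2; apply/eqP; rewrite eq_mulgV1 -order_eq1.
  have dp : #[u * v^-1] %| p by rewrite -oxp orderE order_dvdG // groupM ?groupV.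
  have : #[u * v^-1] %| gcdn 2 p by rewrite dvdn_gcd d2.
  suff -> : gcdn 2 p = 1%N by rewrite dvdn1.
  by apply/eqP; rewrite -/(coprime 2 p) coprime2n; case: (even_prime pr_p) => // e; rewrite e in p4.
have sqM : {in A &, {morph (fun z : gT => z ^+ 2) : u v / u * v}}.
  by move=> u v _ _; rewrite /= expgMn //; apply: mulC.
have sqA : {in A, forall z, z ^+ 2 \in A} by move=> z zA; apply: groupX.
have := haar_affine (haar_iso_fiberwise sqM sqI sqA A0A (fun a d => @coset_absorb A x a d)).
have T0E : [set z ^+ 2 | z in A0] = [set 1; x ^+ (2 * p)].
  by rewrite /A0 imset_pair expg1n -expgM mulnC.
rewrite T0E => /affine_equiv_coset[//|||||].
- by rewrite !inE eqxx.
- exact: A0A.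
- by rewrite -T0E; apply/subsetP=> _ /imsetP[z /(subsetP A0A) zA ->]; apply: sqA.
- by rewrite -orderE oxp cards2; case: eqP => _; lia.
move=> g [f [i [fM fx gT0 /(_ (x ^+ p))]]]; rewrite !inE eqxx orbT => /(_ isT).
have fX n : f (x ^+ n) = f x ^+ n.
  by elim: n => [|n IH]; rewrite ?expg0 ?morph_perm1 // !expgS fM IH.
have -> : f (x ^+ p) = x ^+ p.
  apply/eqP; rewrite fX fx -expgM eqx.
  have -> : ((1 + p * i) * p = i * p ^ 2 + p)%N by rewrite expnS expn1; nia.
  by rewrite modnMDl.
have nz k : 0 < k < 4 -> (x ^+ (k * p) == 1) = false.
  move=> k4; rewrite -order_dvdn ox expnS expn1 dvdn_pmul2r //.
  by apply/negP=> /dvdn_leq; lia.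
move: gT0; rewrite !inE => /orP[]/eqP->.
  rewrite mul1g -[p in x ^+ p]mul1n nz //= => /eqP.
  rewrite mul1n mul2n -addnn expgD -{1}[x ^+ p]mulg1 => /mulgI/esym/eqP.
  by rewrite -[p in x ^+ p]mul1n nz.
case/orP; first by rewrite -expgD -mulSnr nz.
rewrite -{2}[x ^+ (2 * p)]mulg1 => /eqP/mulgI/eqP.
by rewrite -[p in x ^+ p]mul1n nz.
Qed.

(** Invert the elements of A only. In exponents of x^3 modulo 9, {0, 1, 3} becomes {0, 8, 6};
    multipliers 1 + 3i are trivial modulo 3, where the residues 0, 1, 0 and 0, 2, 0 are not
    translates of each other. *)
Lemma no_order_27 x : #[x] <> 27.
Proof.
move=> ox; pose A := <[x ^+ 3]>%G.
have oxp : #[x ^+ 3] = 9 by rewrite orderXdiv ox.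
have eqx i j : (x ^+ i == x ^+ j) = (i == j %[mod 27]) by rewrite eq_expg_mod_order ox.
have xA : x \notin A.
  by apply/negP=> xA; have := order_dvdG xA; rewrite -orderE oxp ox.
pose A0 := [set 1; x ^+ 3; x ^+ 9].
have A0A : A0 \subset A.
  apply/subsetP=> u; rewrite !inE => /orP[/orP[]|]/eqP->; rewrite ?group1 ?cycle_id //.
  by rewrite -[9]/(3 * 3)%N expgM mem_cycle.
have vI : {in A &, injective (fun z : gT => z^-1)} by move=> u v _ _ /invg_inj.
have vM : {in A &, {morph (fun z : gT => z^-1) : u v / u * v}}.
  by move=> u v _ _; rewrite /= invMg mulC.
have vA : {in A, forall z, z^-1 \in A} by move=> z zA; rewrite groupV.
have := haar_affine (haar_iso_fiberwise vM vI vA A0A (fun a d => @coset_absorb A x a d)).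
have T0E : [set z^-1 | z in A0] = [set 1; x ^+ 24; x ^+ 18].
  rewrite /A0 imsetU imset_pair imset_set1 invg1; congr [set _; _; _];
    by apply/eqP; rewrite eq_invg_mul -expgD -order_dvdn ox.
rewrite T0E => /affine_equiv_coset[//|||||].
- by rewrite !inE eqxx.
- exact: A0A.
- by rewrite -T0E; apply/subsetP=> _ /imsetP[z /(subsetP A0A) zA ->]; apply: vA.
- rewrite -orderE oxp; apply: leq_ltn_trans (_ : 3 < 9) => //.
  apply: leq_trans (leq_card_setU _ _) _; rewrite cards1 addn1 cards2; by case: eqP.
move=> g [f [i [fM fx gT0 fA0]]].
have fX n : f (x ^+ n) = x ^+ ((1 + 3 * i) * n).
  by rewrite expgM -fx; elim: n => [|n IH]; rewrite ?expg0 ?morph_perm1 // !expgS fM IH.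
have := fA0 (x ^+ 3); have := fA0 (x ^+ 9); rewrite !inE !eqxx !orbT !fX => /(_ isT) + /(_ isT).
have e1 : 1 = x ^+ 0 by rewrite expg0.
move: gT0; rewrite !inE e1 => /orP[/orP[]|]/eqP->; rewrite -!expgD !eqx; lia.
Qed.

(** f adds 2 to odd exponents. The odd parts {1, 5} and {3, 7} are invariant under adding 4, so
    shifts by 2 and -2 agree and the same f serves on both parts. S contains the progression 0, 1,
    2, while T has no progression of three distinct terms modulo 8. *)
Lemma no_order_8 x : #[x] <> 8.
Proof.
move=> ox; pose C := <[x]>%G.
have eqx i j : (x ^+ i == x ^+ j) = (i == j %[mod 8]) by rewrite eq_expg_mod_order ox.
have e1 : 1 = x ^+ 0 by rewrite expg0.
have eqx1 i : (x ^+ i == x) = (i == 1 %[mod 8]) by rewrite -{2}[x]expg1 eqx.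
pose S := [set 1; x; x ^+ 2; x ^+ 5]; pose T := [set 1; x ^+ 2; x ^+ 3; x ^+ 7].
have SC : S \subset C.
  by apply/subsetP=> u; rewrite !inE => /orP[/orP[/orP[]|]|]/eqP->; rewrite ?group1 ?cycle_id ?mem_cycle.
have TC : T \subset C.
  by apply/subsetP=> u; rewrite !inE => /orP[/orP[/orP[]|]|]/eqP->; rewrite ?group1 ?cycle_id ?mem_cycle.
pose f u := if u \in <[x ^+ 2]> then u else x ^+ 2 * u.
have fE i : f (x ^+ i) = x ^+ (if odd i then i.+2 else i).
  rewrite /f; have -> : (x ^+ i \in <[x ^+ 2]>) = ~~ odd i.
    apply/cycleP/idP=> [[k /eqP]|oi]; last first.
      by exists i./2; rewrite -expgM mul2n -[LHS]/(x ^+ i) -{1}(odd_double_half i) (negPf oi).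
    by rewrite -expgM eqx; lia.
  by case: (odd i); rewrite //= -expgD.
have fC : {in C, forall z, f z \in C}.
  by move=> _ /cycleP[i ->]; rewrite fE mem_cycle.
have fI : {in C &, injective f}.
  move=> _ _ /cycleP[i ->] /cycleP[j ->]; rewrite !fE => /eqP e; apply/eqP; move: e.
  by rewrite !eqx; case: ifP; case: ifP; lia.
have xV i : (x ^+ i)^-1 = x ^+ (7 * i).
  by apply/eqP; rewrite eq_invg_mul -expgD e1 eqx; lia.
have /haar_affine[g [h [hM TE]]] : haar_iso S T.
  apply: (haar_iso_lift SC TC fC fC fI fI) => _ _ /cycleP[i ->] /cycleP[j ->].
  by rewrite !fE !xV -!expgD !inE {1 2}e1 !eqx eqx1; case: ifP; case: ifP; lia.
have hX n : h (x ^+ n) = h x ^+ n.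
  by elim: n => [|n IH]; rewrite ?expg0 ?morph_perm1 // !expgS hM IH.
have TS u : u \in S -> g * h u \in T by move=> uS; rewrite TE; apply/imsetP; exists u.
have gT1 : exists2 i, g = x ^+ i & i \in [:: 0; 2; 3; 7]%N.
  have := TS 1; rewrite !inE eqxx morph_perm1 // mulg1 => /(_ isT).
  by rewrite e1 => /orP[/orP[/orP[]|]|]/eqP->; [exists 0 | exists 2 | exists 3 | exists 7].
have [i gE i4] := gT1; have [k hxE] : exists k, h x = x ^+ k.
  have xS : x \in S by rewrite !inE eqxx !orbT.
  have := subsetP TC _ (TS x xS).
  by rewrite groupMl ?gE ?mem_cycle // => /cycleP.
have := TS x; have := TS (x ^+ 2); rewrite !inE !eqxx !orbT !hX hxE gE => /(_ isT) + /(_ isT).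
have k_nz : k %% 8 != 0.
  apply: contraFN (_ : x == 1 = false) => [k0|]; last by rewrite e1 -[x in x == _]expg1 eqx.
  by rewrite -(inj_eq (@perm_inj _ h)) hxE morph_perm1 // e1 eqx mod0n.
have k2_nz : (k * 2) %% 8 != 0.
  apply: contraFN (_ : x ^+ 2 == 1 = false) => [k0|]; last by rewrite e1 eqx.
  by rewrite -(inj_eq (@perm_inj _ h)) hX hxE morph_perm1 // e1 -expgM eqx mod0n.
rewrite e1 -!expgM -!expgD !eqx; move: i4; rewrite !inE.
by case/or4P=> /eqP->; lia.
Qed.

End Exclusions.

(** * Excluded elementary abelian subgroups of order 27 *)

Section Elementary27.

Local Open Scope nat_scope.

(* The code 9 t + 3 s + z stands for the vector (t, s, z) of F_3 ^ 3. *)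
Definition vec3 t s z := t %% 3 * 9 + s %% 3 * 3 + z %% 3.
Definition add3 j k := vec3 (j %/ 9 + k %/ 9) (j %/ 3 + k %/ 3) (j + k).
Definition opp3 k := vec3 (2 * (k %/ 9)) (2 * (k %/ 3)) (2 * k).
(** Over each t, a full line in direction z at s = t^2 and a single point at s = t^2 + k. *)
Definition parabola k := [seq vec3 t (t * t) z | t <- iota 0 3, z <- iota 0 3]
  ++ [seq vec3 t (t * t + k) 0 | t <- iota 0 3].
(** flip1(t, s, z) = (t, t^2 - s, z) and flip2(t, s, z) = (-t, -s - t^2, z). Passing from v - u to
    flip2(v) - flip1(u) negates s - t^2 and keeps z, so it exchanges k = 2 and k = 1. *)
Definition flip1 k := vec3 (k %/ 9) (k %/ 9 * (k %/ 9) + 2 * (k %/ 3)) k.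
Definition flip2 k := vec3 (2 * (k %/ 9)) (2 * (k %/ 3) + 2 * (k %/ 9 * (k %/ 9))) k.
Definition zero_sums3 (L : seq nat) := sumn [seq count (fun k => opp3 (add3 j k) \in L) L | j <- L].

Lemma flip_parabola : all (fun j => all (fun k =>
  (add3 k (opp3 j) \in parabola 2) == (add3 (flip2 k) (opp3 (flip1 j)) \in parabola 1)) (iota 0 27)) (iota 0 27).
Proof. by vm_compute. Qed.

(* The two numbers are 48 and 84; an affine map g * h u with g ^+ 3 = 1 preserves them. *)
Lemma zero_sums3_parabola : zero_sums3 (parabola 2) != zero_sums3 (parabola 1).
Proof. by vm_compute. Qed.

Lemma vec3_lt t s z : vec3 t s z < 27.
Proof. by rewrite /vec3; lia. Qed.

Local Open Scope group_scope.

Variable gT : finGroupType.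
Hypothesis abG : abelian [set: gT].
Hypothesis haar_affine : forall S T : {set gT}, haar_iso S T -> affine_equiv S T.
Let mulC : commutative (@mulg gT) := abelian_mulgC abG.

Variables (E : {group gT}) (a d c : gT).
Hypotheses (a3 : a ^+ 3 = 1) (d3 : d ^+ 3 = 1) (c3 : c ^+ 3 = 1).
Hypotheses (EE : <[a]> * <[d]> * <[c]> = E) (oE : #|E| = 27).

(** Exponents count modulo 3 only, so [k %/ 3] and [k] stand for the middle and last digits of k in
    base 3. *)
Definition el k := a ^+ (k %/ 9) * d ^+ (k %/ 3) * c ^+ k.

Lemma exp_mod3 (u : gT) m n : u ^+ 3 = 1 -> m = n %[mod 3] -> u ^+ m = u ^+ n.
Proof.
move=> u3 mn; rewrite (divn_eq m 3) (divn_eq n 3) !expgD ![(_ * 3)%N]mulnC !expgM u3 !expg1n.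
by rewrite mn.
Qed.

Lemma el_vec3 t s z : el (vec3 t s z) = a ^+ t * d ^+ s * c ^+ z.
Proof.
rewrite /el /vec3; congr (_ * _ * _); apply: exp_mod3 => //.
- by lia.
- by lia.
by lia.
Qed.

Lemma el_add3 j k : el (add3 j k) = el j * el k.
Proof.
rewrite el_vec3 !expgD /el -!mulgA; congr (_ * _); rewrite !mulgA.
rewrite [LHS](_ : _ = d ^+ (j %/ 3) * c ^+ j * (a ^+ (k %/ 9) * d ^+ (k %/ 3) * c ^+ k)) ?mulgA //.
rewrite (mulC (a ^+ _)) -!mulgA; congr (_ * _).
by rewrite !mulgA (mulC _ (c ^+ j)) !mulgA.
Qed.

Lemma el_expg3 k : el k ^+ 3 = 1.
Proof.
rewrite /el !expgMn; try exact: mulC.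
by rewrite -!expgM ![(_ * 3)%N]mulnC !expgM a3 d3 c3 !expg1n !mulg1.
Qed.

Lemma el_opp3 k : el (opp3 k) = (el k)^-1.
Proof.
apply: (mulIg (el k)); rewrite mulVg -(el_expg3 k) expgSr expgS expg1; congr (_ * _).
by rewrite -el_add3 !el_vec3 !mul2n -!addnn.
Qed.

Lemma el_surj g : g \in E -> exists2 k, k < 27 & g = el k.
Proof.
rewrite -EE => /mulsgP[_ _ /mulsgP[_ _ /cycleP[t ->] /cycleP[s ->] ->] /cycleP[z ->] ->].
by exists (vec3 t s z); rewrite ?vec3_lt ?el_vec3.
Qed.

Lemma el_in k : el k \in E.
Proof. by rewrite -EE /el !mem_mulg ?mem_cycle. Qed.

Lemma el_inj : {in iota 0 27 &, injective el}.
Proof.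
have u : uniq [seq el k | k <- iota 0 27].
  apply: (@leq_size_uniq _ (enum E)); first exact: enum_uniq.
    move=> g; rewrite mem_enum => /el_surj[k lt_k ->].
    by apply: map_f; rewrite mem_iota.
  by rewrite size_map size_iota -cardE oE.
move=> j k; rewrite !mem_iota /= => lt_j lt_k e.
have := nth_uniq 1 (s := [seq el k | k <- iota 0 27]) (i := j) (j := k).
rewrite !size_map !size_iota => /(_ lt_j lt_k u).
by rewrite !(nth_map 0%N) ?size_iota // !nth_iota // e eqxx => /esym/eqP.
Qed.

Definition zero_sums (L : seq gT) := sumn [seq count (fun v => (u * v)^-1 \in L) L | u <- L].

Lemma zero_sums_perm L L' : perm_eq L L' -> zero_sums L = zero_sums L'.
Proof.
move=> pL; rewrite /zero_sums.
have -> : [seq count (fun v => (u * v)^-1 \in L) L | u <- L]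
        = [seq count (fun v => (u * v)^-1 \in L') L' | u <- L].
  apply: eq_map => u; have /seq.permP <- := pL; apply: eq_count => v.
  by rewrite (perm_mem pL).
by apply: perm_sumn; apply: perm_map.
Qed.

Lemma zero_sums_affine (L : seq gT) (h : {perm gT}) g :
  {morph h : x y / x * y} -> g ^+ 3 = 1 -> zero_sums (map (fun u => g * h u) L) = zero_sums L.
Proof.
move=> hM g3; have i : injective (fun u => g * h u) by move=> u v /mulgI/perm_inj.
rewrite /zero_sums -map_comp; congr sumn; apply/eq_in_map => u uL /=.
rewrite count_map; apply: eq_in_count => v vL /=.
suff -> : (g * h u * (g * h v))^-1 = g * h (u * v)^-1 by rewrite (mem_map i).
apply: (mulgI (g * h u * (g * h v))); rewrite mulgV (morph_permV hM) hM.
have gg (x y : gT) : g * x * (g * y) * (g * (x * y)^-1) = g ^+ 3.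
  have -> : g * x * (g * y) = g * g * (x * y) by rewrite -mulgA (mulgA x) (mulC x g) !mulgA.
  by rewrite (mulC g _^-1) mulgA mulgK.
by rewrite gg g3.
Qed.

Lemma zero_sums_el (L : seq nat) : {subset L <= iota 0 27} -> zero_sums (map el L) = zero_sums3 L.
Proof.
move=> L27; rewrite /zero_sums /zero_sums3 -map_comp; congr sumn; apply/eq_in_map => j jL /=.
rewrite count_map; apply: eq_in_count => k kL /=.
rewrite -el_add3 -el_opp3; apply/mapP/idP=> [[l lL /el_inj -> //]|]; last by exists (opp3 (add3 j k)).
  by rewrite mem_iota /= vec3_lt.
exact: L27.
Qed.

(** The flips, lifted from E to the whole group, make the two parabola sets isomorphic; their
    numbers of zero-sum triples show that they are not affinely equivalent. *)
Lemma no_elementary27 : False.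
Proof.
pose P k := [set g in map el (parabola k)].
have P27 k : {subset parabola k <= iota 0 27}.
  move=> j; rewrite mem_cat => /orP[/allpairsP[[t z] [_ _ ->]]|/mapP[t _ ->]];
    by rewrite mem_iota /= vec3_lt.
have PE k : P k \subset E.
  by apply/subsetP=> g; rewrite inE => /mapP[j _ ->]; apply: el_in.
have elP k j : j < 27 -> (el j \in P k) = (j \in parabola k).
  move=> lt_j; rewrite inE; apply/mapP/idP=> [[l lP /el_inj -> //]|]; last by exists j.
    by rewrite mem_iota.
  exact: P27 lP.
pose code (g : gT) := index g (map el (iota 0 27)).
have elK k : k < 27 -> code (el k) = k.
  move=> lt_k; rewrite /code; have := nth_map 0%N 1 el (n := k) (s := iota 0 27).
  rewrite size_iota => /(_ lt_k); rewrite nth_iota // => <-; rewrite index_uniq ?size_map ?size_iota //.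
  by rewrite map_inj_in_uniq ?iota_uniq //; apply: el_inj.
pose F (f : nat -> nat) (g : gT) := el (f (code g)).
have FE f : {in E, forall g, F f g \in E} by move=> g _; apply: el_in.
have FI f : (forall k, f k < 27) -> uniq (map f (iota 0 27)) -> {in E &, injective (F f)}.
  move=> f27 uf _ _ /el_surj[j lt_j ->] /el_surj[k lt_k ->].
  rewrite /F !elK // => /el_inj; rewrite !mem_iota /= !f27 => /(_ isT isT) e.
  congr el; apply/eqP.
  have := nth_uniq 0%N (s := map f (iota 0 27)) (i := j) (j := k).
  rewrite !size_map !size_iota => /(_ lt_j lt_k uf).
  by rewrite !(nth_map 0%N) ?size_iota // !nth_iota // e eqxx => /esym.
have /haar_affine[g [h [hM TE]]] : haar_iso (P 2) (P 1%N).
  have I1 : {in E &, injective (F flip1)} by apply: FI => [k|]; [apply: vec3_lt | vm_compute].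
  have I2 : {in E &, injective (F flip2)} by apply: FI => [k|]; [apply: vec3_lt | vm_compute].
  apply: (haar_iso_lift (PE 2) (PE 1%N) (FE flip1) (FE flip2) I1 I2).
  move=> _ _ /el_surj[j lt_j ->] /el_surj[k lt_k ->].
  have /allP/(_ j) := flip_parabola; rewrite mem_iota lt_j => /(_ isT).
  move/allP/(_ k); rewrite mem_iota lt_k => /(_ isT)/eqP.
  by rewrite /F !elK -?el_opp3 -?el_add3 ?elP ?vec3_lt.
have P0 k : 1 \in P k.
  by have -> : 1 = el 0; [rewrite /el !mulg1 | rewrite elP // mem_cat].
(* 1 lies in [P 2], so its image g lies in [P 1], inside E of exponent 3. *)
have g3 : g ^+ 3 = 1.
  have : g \in P 1%N.
    by rewrite TE; apply/imsetP; exists 1; rewrite ?P0 // morph_perm1 ?mulg1.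
  by move/(subsetP (PE 1%N)) => /el_surj[k _ ->]; apply: el_expg3.
have hV := morph_permV hM.
have i : injective (fun u => g * h u) by move=> u v /mulgI/perm_inj.
have uP k : uniq (map el (parabola k)) = uniq (parabola k).
  by rewrite map_inj_in_uniq // => u v /P27 u27 /P27 v27; apply: el_inj.
have pP : perm_eq (map el (parabola 1%N)) (map (fun u => g * h u) (map el (parabola 2))).
  apply: uniq_perm; rewrite ?(map_inj_uniq i) ?uP //.
  move=> v; transitivity (v \in P 1%N); first by rewrite in_set.
  rewrite TE; apply/imsetP/mapP=> -[u].
    by rewrite in_set => uL ->; exists u.
  by move=> uL ->; exists u; rewrite ?in_set.
have := zero_sums_perm pP; rewrite (zero_sums_el (P27 1%N)).
rewrite (zero_sums_affine _ hM g3) (zero_sums_el (P27 2)) => e.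
exact: (elimN eqP zero_sums3_parabola (esym e)).
Qed.

End Elementary27.

Lemma cyclic_isog_Zp (gT : finGroupType) (P : {group gT}) n :
  cyclic P -> #|P| = n.+2 -> P \isog [set: 'Z_n.+2].
Proof.
move=> cP oP; rewrite isog_cyclic_card // cardsT card_ord oP eqxx andbT.
by apply/cyclicP; exists Zp1; apply: Zp_cycle.
Qed.

Lemma Z3xZ3_abelem : 3.-abelem [set: ('Z_3 * 'Z_3)%type].
Proof.
apply/abelemP => //; split.
  by apply/centsP=> x _ y _; congr (_, _); apply: Zp_mulgC.
have e (z : 'Z_3) : z * (z * z) = 1 by apply: val_inj; case: z => [[|[|[|]]]].
by move=> [x y] _; congr (_, _); apply: e.
Qed.

(** * Sylow subgroups of abelian K2PCI-groups *)

Section AbelianSylow.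

Variable gT : finGroupType.
Hypothesis abG : abelian [set: gT].
Hypothesis haar_affine : forall S T : {set gT}, haar_iso S T -> affine_equiv S T.

Lemma pgroup_abelem_or_cyclic (p : nat) (P : {group gT}) :
  prime p -> p.-group P -> p.-abelem P \/ cyclic P.
Proof.
move=> pr_p pP; have abP : abelian P by apply: abelianS abG; apply: subsetT.
have [r1|r2] := leqP 'r_p(P) 1; [right | left].
  by rewrite abelian_rank1_cyclic // (rank_pgroup pP).
by apply/abelemP => //; split=> //; apply: p_rank2_exponent.
Qed.

Lemma cyclic_logn_lt (p m : nat) (P : {group gT}) :
  prime p -> (forall x : gT, #[x] <> (p ^ m)%N) -> p.-group P -> cyclic P -> logn p #|P| < m.
Proof.
move=> pr_p no_pm pP /cyclicP[x Px]; rewrite ltnNge; apply/negP=> le_m.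
have ox : #[x] = (p ^ logn p #|P|)%N by rewrite orderE -Px {1}(card_pgroup pP).
apply: (no_pm (x ^+ (p ^ (logn p #|P| - m)))).
by rewrite (orderXexp _ ox) subKn.
Qed.

(** Rank 3 gives a subgroup of order exactly 27, whose generators are chosen in turn outside the
    span of the earlier ones. *)
Lemma abelem3_logn_lt (P : {group gT}) : 3.-abelem P -> logn 3 #|P| < 3.
Proof.
move=> abP; rewrite ltnNge -(p_rank_abelem abP); apply/negP=> /p_rank_geP[E /pnElemP[_ abE lE]].
have oE : #|E| = 27 by rewrite (card_pgroup (abelem_pgroup abE)) lE.
have E3 u : u \in E -> u ^+ 3 = 1 by have /abelemP[//|_] := abE; apply.
have oe u : u \in E -> u != 1 -> #[u] = 3 by move=> uE u1; apply: (abelem_order_p abE).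
have outside (A : {group gT}) : A \subset E -> #|A| < 27 ->
    exists2 u, u \in E & #|A * <[u]>| = (#|A| * 3)%N.
  move=> sAE lA; have /subsetPn[u uE uA] : ~~ (E \subset A).
    by apply/negP=> /subset_leq_card; rewrite oE leqNgt lA.
  have ou : #[u] = 3 by apply: oe => //; apply: contraNneq uA => ->.
  exists u => //; rewrite TI_cardMg -?orderE ?ou // setIC prime_TIg -?orderE ?ou //.
  by rewrite cycle_subG.
have [|//|a aE] := outside 1%G; rewrite ?sub1G ?cards1 // mul1g mul1n => oA.
have [||d dE oAD] := outside <[a]>%G; rewrite ?cycle_subG ?oA //.
have gAD : <[a]> * <[d]> = (<[a]> <*> <[d]>)%G.
  by rewrite /= norm_joinEr // cents_norm // (centsS (subsetT _)) // (subset_trans (subsetT _) abG).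
have sAD : (<[a]> <*> <[d]>)%G \subset E by rewrite join_subG !cycle_subG aE.
have [|c cE] := outside _ sAD; rewrite -gAD oAD oA // => oADC.
apply: (@no_elementary27 _ abG haar_affine E a d c); rewrite ?E3 //.
apply/eqP; rewrite eqEcard oE oADC andbT gAD.
by rewrite mul_subG // cycle_subG.
Qed.

Lemma sylow3_of_haar_affine (P : {group gT}) :
  3 %| #|gT| -> 3.-Sylow([set: gT]) P ->
  [\/ P \isog [set: 'Z_3], P \isog [set: ('Z_3 * 'Z_3)%type] | P \isog [set: 'Z_9]].
Proof.
move=> d3 sylP; have pP := pHall_pgroup sylP.
have l0 : 0 < logn 3 #|P|.
  by rewrite (card_Hall sylP) logn_part logn_gt0 mem_primes cardG_gt0 cardsT d3.
have [abP|cP] := pgroup_abelem_or_cyclic (isT : prime 3) pP.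
  have := abelem3_logn_lt abP; have := card_pgroup pP.
  case: (logn 3 #|P|) l0 => [|[|[|]]] // _ oP _.
    by apply: Or31; apply: cyclic_isog_Zp; rewrite ?prime_cyclic ?oP.
  by apply: Or32; rewrite (isog_abelem_card _ abP) oP cardsT card_prod card_ord Z3xZ3_abelem.
have := cyclic_logn_lt (m := 3) (isT : prime 3) (@no_order_27 _ abG haar_affine) pP cP.
have := card_pgroup pP.
case: (logn 3 #|P|) l0 => [|[|[|]]] // _ oP _.
  by apply: Or31; apply: cyclic_isog_Zp.
by apply: Or33; apply: cyclic_isog_Zp.
Qed.

Lemma sylow_of_haar_affine (p : nat) (P : {group gT}) :
  prime p -> p != 3 -> p.-Sylow([set: gT]) P -> p.-abelem P \/ P \isog [set: 'Z_4].
Proof.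
move=> pr_p p3 sylP; have pP := pHall_pgroup sylP.
have small : cyclic P -> logn p #|P| < 2 -> p.-abelem P.
  move=> cP; rewrite ltnS => l1; apply/abelemP => //; split; first exact: cyclic_abelian.
  move=> x xP; apply/eqP; rewrite -order_dvdn (dvdn_trans (order_dvdG xP)) //.
  by rewrite (card_pgroup pP); apply: (@dvdn_exp2l p _ 1).
have [|cP] := pgroup_abelem_or_cyclic pr_p pP; first by left.
have [p4|] := ltnP 4 p.
  left; apply: small => //; apply: cyclic_logn_lt pP cP => // x.
  exact: no_order_p2.
case: p pr_p p3 sylP pP small => [|[|[|[|[|]]]]] // _ _ _ pP small _.
have := cyclic_logn_lt (m := 3) (isT : prime 2) (@no_order_8 _ haar_affine) pP cP.
have [l2 _|l2] := ltnP (logn 2 #|P|) 2; first by left; apply: small.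
rewrite ltnS => l2'; have := card_pgroup pP.
have -> : logn 2 #|P| = 2 by apply/eqP; rewrite eqn_leq l2 l2'.
by move=> oP; right; apply: cyclic_isog_Zp.
Qed.

End AbelianSylow.

(** If 3 does not divide |G| the condition at 3 is void, but then the Sylow 3-subgroup is
    trivial. *)
Lemma sylow_homogeneous (gT : finGroupType) :
  (3 %| #|gT| -> forall P : {group gT}, 3.-Sylow([set: gT]) P ->
     [\/ P \isog [set: 'Z_3], P \isog [set: ('Z_3 * 'Z_3)%type] | P \isog [set: 'Z_9]]) ->
  (forall (p : nat) (P : {group gT}), prime p -> p != 3 -> p.-Sylow([set: gT]) P ->
     p.-abelem P \/ P \isog [set: 'Z_4]) ->
  forall (p : nat) (P : {group gT}), prime p -> p.-Sylow([set: gT]) P -> p.-abelem P \/ cyclic P.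
Proof.
move=> syl3 syl p P pr_p sylP.
have cZ n : cyclic [set: 'Z_n.+2] by apply/cyclicP; exists Zp1; apply: Zp_cycle.
have [p3|p3] := eqVneq p 3; last first.
  by have [|/isog_cyclic->] := syl p P pr_p p3 sylP; [left | right; apply: cZ].
move: sylP; rewrite {}p3 => sylP; have [d3|nd3] := boolP (3 %| #|gT|); last first.
  left; have -> : P = 1%G; last exact: abelem1.
  apply/val_inj/eqP; rewrite /= trivg_card1 (card_Hall sylP) part_p'nat // p'natE // cardsT //.
have [/isog_cyclic->|isoP|/isog_cyclic->] := syl3 d3 P sylP; [right; apply: cZ | left | right; apply: cZ].
by rewrite (isog_abelem isoP) Z3xZ3_abelem.
Qed.

Theorem theorem1p7 (G : finGroupType) :
  (abelian [set: G] ->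
     (K2PCI_group G <->
      [/\ 3 %| #|G| ->
          forall P : {group G}, 3.-Sylow([set: G]) P ->
            [\/ P \isog [set: 'Z_3],
                P \isog [set: ('Z_3 * 'Z_3)%type]
              | P \isog [set: 'Z_9]],
          forall (p : nat) (P : {group G}),
            prime p -> p != 3 -> p.-Sylow([set: G]) P ->
            p.-abelem P \/ P \isog [set: 'Z_4]
        & forall S : {set G},
            @K2PCI (subg_of <<S>>) (@BCay (subg_of <<S>>) (sgval @^-1: S))]))
  /\
  (~ abelian [set: G] ->
     (K2PCI_group G <->
      [\/ [set: G] \isog 'D_6, [set: G] \isog 'Q_8 | [set: G] \isog 'D_10])).
Proof.
have affine : K2PCI_group G -> forall S : {set G},
    (forall T, haar_iso S T -> affine_equiv S T) /\ affine_equiv S S^-1.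
  by move=> kG S; apply/K2PCI_BCayP/kG; exists S.
split=> [abG | /negP nabG]; split.
- move=> /affine aG; have haar_affine (S T : {set G}) : haar_iso S T -> affine_equiv S T by apply: (aG S).1.
  have syl3 := sylow3_of_haar_affine abG haar_affine.
  have syl := sylow_of_haar_affine abG haar_affine.
  split=> // [d3 P|S]; first exact: syl3.
  have hom := sylow_homogeneous (fun d3 P => @syl3 P d3) syl.
  exact: (abelian_K2PCI_group_sub abG hom haar_affine (L := <<S>>%G) (subset_gen S)).
- case=> syl3 syl; apply: abelian_K2PCI_group_suff => //; exact: sylow_homogeneous.
- move=> /affine aG; apply: nonabelian_K2PCI_group => // [S T|S]; first exact: (aG S).1.
  exact: (aG S).2.
case.
- exact: (dihedral_K2PCI (n := 3) isT mcheck_D6).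
- exact: quaternion8_K2PCI.
exact: (dihedral_K2PCI (n := 5) isT mcheck_D10).
Qed.
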